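(* Let $(\lambda_n)_{n\ge 0}$ be real numbers with $0=\lambda_0<\lambda_1<\lambda_2<\cdots$. Let $A_0=1$ and let $A_n$, $n\ge 1$, be positive real numbers. Define $$\Lambda(x)=\sum_{\lambda_n\le x}A_n,$$ and suppose that $$\int_1^\infty\frac{\log\Lambda(x)}{x^2}\,dx<\infty .$$ Then for each $H>0$, $$\lim_{N\to\infty}\ \min_{|a_n|\le A_n}\ \int_0^H\left|1+\sum_{n=1}^N a_n e^{-i\lambda_n t}\right|dt>0 .$$
   Context: The sum defining $\Lambda(x)$ runs over all $n\ge 0$ with $\lambda_n\le x$. For each $N$ the minimum is taken over all complex numbers $a_1,\dots,a_N$ with $|a_n|\le A_n$ for $1\le n\le N$. *)

(* Defs.v *)
From HB Require Import structures.
From mathcomp Require Import all_boot all_order all_algebra.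
From mathcomp Require Import all_classical all_reals all_analysis.
From mathcomp Require Import complex.

Set Implicit Arguments.
Unset Strict Implicit.
Unset Printing Implicit Defensive.
Import Order.TTheory GRing.Theory Num.Theory.
Import numFieldNormedType.Exports.

Local Open Scope classical_set_scope.
Local Open Scope ring_scope.

(* The sum is taken in \bar R: no growth condition is put on lam, so
   infinitely many n may satisfy lam n <= x. *)
Definition Lambda (R : realType) (lam A : R^nat) (x : R) : \bar R :=
  (\esum_(n in [set n | (lam n <= x)%R]) (A n)%:E)%E.

(* e^{i theta} *)
Definition expi (R : realType) (theta : R) : R[i] :=
  Complex (cos theta) (sin theta).

Definition L1dist (R : realType) (lam : R^nat) (H : R) (N : nat)
    (a : nat -> R[i]) : R :=
  \int[lebesgue_measure]_(t in `[0, H])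
    Normc.normc (1 + \sum_(1 <= n < N.+1) a n * expi (- (lam n * t))).

(* Only the terms a 1, ..., a N of the sequence a are constrained or used. *)
Definition admissible (R : realType) (A : R^nat) (N : nat) :
    set (nat -> R[i]) :=
  [set a | forall n, (1 <= n <= N)%N -> Normc.normc (a n) <= A n].

Definition is_minimum (R : realType) (S : set R) (m : R) : Prop :=
  S m /\ lbound S m.

(* Main.v *)
Require Import Defs.
From HB Require Import structures.
From mathcomp Require Import all_boot all_order all_algebra.
From mathcomp Require Import all_classical all_reals all_analysis.
From mathcomp Require Import complex.
From mathcomp Require Import measurable_realfun ring lra.

Set Implicit Arguments.
Unset Strict Implicit.
Unset Printing Implicit Defensive.
Import Order.TTheory GRing.Theory Num.Theory.
Import numFieldNormedType.Exports.

Local Open Scope classical_set_scope.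
Local Open Scope ring_scope.

(** Apply to f(t) = 1 + sum a_n e^{-i lam_n t} a product of moving averages of
    total length at most H/2.  They multiply a_n by factors which, because the
    logarithmic integral converges, can be chosen so that the new coefficients
    c_n satisfy c_0 = 1 and sum |c_n| <= K with K independent of N, while the
    sup norm of the new sum on [0, H/2] is at most (4/H) \int_0^H |f|.
    So it suffices to bound that sup norm eps from below.
    F(z) = sum c_n e^{-lam_n z} is bounded by K on Re z >= 0 and |F| >= 1/2 at
    p = d + i H/4 for d large.  Take a regular m-gon with centre p and one edge
    inside i[0, H/2], where m is large since d is; it lies in Re z >= 0.  The
    product of the m rotates of F about p is at most eps K^{m-1} on the whole
    boundary, so the maximum principle gives (1/2)^m <= eps K^{m-1}. *)

(** * The modulus and the exponential *)

(** The choice of averages is a length budget. Put S_n = A_0 + ... + A_n. If [a n] is damped by a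
    factor at most S_n^-2, the coefficient sum telescopes to a bound free of N. For frequencies near
    2^k an average of length about 2^-k gains a fixed factor, so about log Λ(2^(k+1)) of them
    suffice, of total length about 2^-k log Λ(2^(k+1)). Summed over k this is comparable with the
    logarithmic integral, so the levels beyond some k0 fit in length H/4, while the frequencies
    below 2^k0 may stay undamped at the cost of a constant. Another H/4 is spent on a single average
    that turns the L1 norm into a sup norm. The obstacle afterwards is that smallness is known on a
    segment only. Multiplying the rotates spreads it around a closed curve and so takes the place of
    an estimate of harmonic measure. *)

Section ComplexModulus.
Context {R : realType}.
Local Notation nm := (@Normc.normc R).
Implicit Types (x y z w : R[i]) (s t : R).

Lemma normc_ge0 z : 0 <= nm z.
Proof. by case: z => a b; exact: sqrtr_ge0. Qed.

Lemma normcD z w : nm (z + w) <= nm z + nm w.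
Proof. exact: (@le_normcD R z w). Qed.

Lemma normc_opp z : nm (- z) = nm z.
Proof. exact: (@normcN R z). Qed.

Lemma normcB z w : nm (z - w) <= nm z + nm w.
Proof. by rewrite -(normc_opp w) normcD. Qed.

Lemma normc_distC z w : nm (z - w) = nm (w - z).
Proof. by rewrite -normc_opp opprB. Qed.

Lemma normcDB z w : nm z - nm w <= nm (z + w).
Proof. by rewrite lerBlDr -{1}(addrK w z) normcB. Qed.

Lemma normc_0 : nm 0 = 0. Proof. exact: Normc.normc0. Qed.

Lemma normc_1 : nm 1 = 1. Proof. exact: Normc.normc1. Qed.

Lemma normcX z n : nm (z ^+ n) = nm z ^+ n.
Proof. by elim: n => [|n IH]; rewrite ?normc_1// !exprS Normc.normcM IH. Qed.

Lemma normc_sum (I : Type) (r : seq I) (P : pred I) (F : I -> R[i]) :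
  nm (\sum_(i <- r | P i) F i) <= \sum_(i <- r | P i) nm (F i).
Proof.
elim/big_ind2 : _ => [|x1 x2 y1 y2 h1 h2|//]; first by rewrite normc_0.
by rewrite (le_trans (normcD _ _))// lerD.
Qed.

Lemma normc_prod (I : Type) (r : seq I) (P : pred I) (F : I -> R[i]) :
  nm (\prod_(i <- r | P i) F i) = \prod_(i <- r | P i) nm (F i).
Proof.
elim/big_ind2 : _ => [|x1 x2 y1 y2 <- <-|//]; first exact: normc_1.
exact: Normc.normcM.
Qed.

Lemma normc_sqr z : nm z ^+ 2 = complex.Re z ^+ 2 + complex.Im z ^+ 2.
Proof. by case: z => a b /=; rewrite sqr_sqrtr// addr_ge0// sqr_ge0. Qed.

Lemma Re_le_normc z : `|complex.Re z| <= nm z.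
Proof.
by case: z => a b /=; rewrite -sqrtr_sqr ler_wsqrtr// lerDl sqr_ge0.
Qed.

Lemma Im_le_normc z : `|complex.Im z| <= nm z.
Proof.
by case: z => a b /=; rewrite -sqrtr_sqr ler_wsqrtr// lerDr sqr_ge0.
Qed.

Lemma normc_le_ReIm z : nm z <= `|complex.Re z| + `|complex.Im z|.
Proof.
rewrite -(@ler_pXn2r _ 2)// ?nnegrE ?addr_ge0 ?normc_ge0//.
by rewrite normc_sqr sqrrD !real_normK ?num_real// lerD2r lerDl mulrn_wge0// mulr_ge0.
Qed.

Lemma normc_real t : nm (Complex t 0) = `|t|.
Proof. by rewrite /= expr0n/= addr0 sqrtr_sqr. Qed.

(** For z nonzero the witness is the conjugate of z divided by its modulus. It turns the modulus of
    an exponential sum into a real part, so that only real functions have to be integrated. *)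
Lemma normc_dual z : exists2 u, nm u = 1 & complex.Re (u * z) = nm z.
Proof.
have [->|z0] := eqVneq z 0.
  by exists 1; rewrite ?normc_1// mulr0 normc_0.
have nz0 : nm z != 0 by apply: contra z0 => /eqP/Normc.eq0_normc ->.
exists (Complex (complex.Re z / nm z) (- (complex.Im z / nm z))).
  apply/eqP; rewrite -(@eqrXn2 _ 2)// ?normc_ge0// normc_sqr/= sqrrN !expr_div_n.
  by rewrite -mulrDl -normc_sqr expr1n divff// expf_neq0.
transitivity (nm z ^+ 2 / nm z); last by rewrite expr2 mulfK.
by rewrite normc_sqr; case: (z) => a b /=; ring.
Qed.

Lemma ReD z w : complex.Re (z + w) = complex.Re z + complex.Re w.
Proof. by case: z; case: w. Qed.

Lemma Re_sum (I : Type) (r : seq I) (P : pred I) (F : I -> R[i]) :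
  complex.Re (\sum_(i <- r | P i) F i) = \sum_(i <- r | P i) complex.Re (F i).
Proof. by apply: (big_morph _ ReD). Qed.

Lemma normc_expi t : nm (expi t) = 1.
Proof. by rewrite /= cos2Dsin2 sqrtr1. Qed.

Lemma expiD s t : expi (s + t) = expi s * expi t.
Proof.
by rewrite /expi cosD sinD; simpc; congr Complex; ring.
Qed.

Lemma expi0 : expi 0 = 1 :> R[i].
Proof. by rewrite /expi cos0 sin0. Qed.

Lemma expiMn t n : expi (t *+ n) = expi t ^+ n.
Proof. by elim: n => [|n IH]; rewrite ?mulr0n ?expi0// mulrS expiD IH exprS. Qed.

Definition cexp z : R[i] := Complex (expR (complex.Re z)) 0 * expi (complex.Im z).

Lemma normc_cexp z : nm (cexp z) = expR (complex.Re z).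
Proof.
by rewrite /cexp Normc.normcM normc_expi mulr1 normc_real ger0_norm ?expR_ge0.
Qed.

Lemma cexpD z w : cexp (z + w) = cexp z * cexp w.
Proof.
case: z w => a b [c d]; rewrite /cexp /= expRD expiD.
have -> : Complex (expR a * expR c) 0 = Complex (expR a) 0 * Complex (expR c) 0.
  by simpc.
by ring.
Qed.

End ComplexModulus.

(** * Second-order expansions *)

Section Taylor.
Context {R : realType}.
Local Notation nm := (@Normc.normc R).
Implicit Types (z w : R[i]) (s t x y : R).

(** Mean value theorem between 0 and x. Each use raises the order of a remainder by one; the
    factorials are given up, since only the order matters. *)
Lemma norm_le_pow_of_deriv (f df : R -> R) (M C : R) (k : nat) :
  (forall x, is_derive x 1 f (df x)) -> f 0 = 0 -> 0 <= C ->
  (forall x, `|x| <= M -> `|df x| <= C * `|x| ^+ k) ->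
  forall x, `|x| <= M -> `|f x| <= C * `|x| ^+ k.+1.
Proof.
move=> fdf f0 C0 dfC x xM.
have cf a b : {within `[a, b], continuous f}.
  apply: continuous_subspaceT => y.
  apply/differentiable_continuous/derivable1_diffP.
  by case: (fdf y).
suff [c [cx ->]] : exists c, `|c| <= `|x| /\ f x = df c * x.
  rewrite normrM exprSr mulrA ler_wpM2r// (le_trans (dfC c (le_trans cx xM)))//.
  by rewrite ler_wpM2l// lerXn2r// nnegrE.
have [x0|x0] := leP 0 x.
  have [c + e] := MVT_segment x0 (fun y _ => fdf y) (cf _ _).
  rewrite in_itv/= => /andP[c0 cx].
  by exists c; split; [rewrite !ger0_norm|move: e; rewrite f0 !subr0].
have [c + e] := MVT_segment (ltW x0) (fun y _ => fdf y) (cf _ _).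
rewrite in_itv/= => /andP[c0 cx].
exists c; split; first by rewrite !ler0_norm// ?(ltW x0)// lerN2.
by move: e; rewrite f0 !sub0r mulrN => /oppr_inj.
Qed.

(** The exponent k covers two bounds at once, by 1 and by |x|; the lemmas built on this one inherit
    the choice. *)
Lemma sin_le_pow (k : nat) x : (k <= 1)%N -> `|sin x| <= 1 * `|x| ^+ k.
Proof.
case: k => [|[|//]] _; first by rewrite mulr1 sin_max.
apply: (@norm_le_pow_of_deriv _ (@cos R) `|x|) => // [|y _]; first exact: sin0.
by rewrite mulr1 cos_max.
Qed.

Lemma is_derive_cosB1 x : is_derive x (1 : R) (fun x => cos x - 1) (- sin x).
Proof. by rewrite -[- sin x]subr0; exact: (@is_deriveB R R R (@cos R) (cst 1)). Qed.

Lemma cos_taylor1 (k : nat) x : (k <= 1)%N ->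
  `|cos x - 1| <= 1 * `|x| ^+ k.+1.
Proof.
move=> k1; apply: (@norm_le_pow_of_deriv (fun x => cos x - 1)
  (fun x => - sin x) `|x|) => // [||y _].
- exact: is_derive_cosB1.
- by rewrite cos0 subrr.
- by rewrite normrN sin_le_pow.
Qed.

Lemma sin_taylor2 (k : nat) x : (k <= 1)%N ->
  `|sin x - x| <= 1 * `|x| ^+ k.+2.
Proof.
move=> k1; apply: (@norm_le_pow_of_deriv (fun x => sin x - x)
  (fun x => cos x - 1) `|x|) => // [|y _].
- by rewrite sin0 subrr.
- exact: cos_taylor1.
Qed.

Lemma is_derive_half_sqr x : is_derive x (1 : R) (fun x : R => 2^-1 * x ^+ 2) x.
Proof.
have -> : (fun x : R => 2^-1 * x ^+ 2) = 2^-1 \*: (@idfun R ^+ 2).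
  by apply/funext => z/=.
apply: is_derive_eq => /=.
by rewrite /GRing.scale/=; field.
Qed.

Lemma cos_taylor2 x : `|cos x - 1 + 2^-1 * x ^+ 2| <= 1 * `|x| ^+ 3.
Proof.
have D := is_derive_cosB1.
have Q := is_derive_half_sqr.
apply: (@norm_le_pow_of_deriv (fun x => cos x - 1 + 2^-1 * x ^+ 2)
  (fun x => - sin x + x) `|x|) => // [|y _].
- by rewrite cos0 subrr add0r expr0n/= mulr0.
- by rewrite -normrN opprD opprK sin_taylor2.
Qed.

Lemma expR_taylor (M x : R) : `|x| <= M ->
  `|expR x - 1 - x - 2^-1 * x ^+ 2| <= expR M * `|x| ^+ 3.
Proof.
move=> xM.
have D y : is_derive y (1 : R) (fun x => expR x - 1) (expR y).
  by rewrite -[expR y]subr0; exact: (@is_deriveB R R R (@expR R) (cst 1)).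
have D' y : is_derive y (1 : R) (fun x => expR x - 1 - x) (expR y - 1).
  by apply: is_deriveB.
have Q := is_derive_half_sqr.
apply: (@norm_le_pow_of_deriv (fun x => expR x - 1 - x - 2^-1 * x ^+ 2)
  (fun x => expR x - 1 - x) M) => //.
- by rewrite expR0 subrr expr0n/= mulr0 !subr0.
apply: (@norm_le_pow_of_deriv (fun x => expR x - 1 - x) (fun x => expR x - 1) M) => //.
- by rewrite expR0 !subrr.
apply: (@norm_le_pow_of_deriv (fun x => expR x - 1) (@expR R) M) => //.
- by rewrite expR0 !subrr.
by move=> y yM; rewrite mulr1 ger0_norm ?expR_ge0// ler_expR (le_trans (ler_norm _)).
Qed.

Lemma expi_taylor t : nm (expi t - Complex (1 - 2^-1 * t ^+ 2) t) <= 2 * `|t| ^+ 3.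
Proof.
apply: le_trans (normc_le_ReIm _) _ => /=.
have := cos_taylor2 t; have := @sin_taylor2 1 t isT.
have -> : cos t - (1 - 2^-1 * t ^+ 2) = cos t - 1 + 2^-1 * t ^+ 2 by ring.
lra.
Qed.

Lemma cexp_taylor (M : R) : 0 <= M -> exists C, forall w, nm w <= M ->
  nm (cexp w - (1 + w + (Complex 2^-1 0) * w ^+ 2)) <= C * nm w ^+ 3.
Proof.
move=> M0.
exists (expR M * 2 + expR M * (1 + M + M ^+ 2) + (M + 2)).
move=> [x y] wM; set w := Complex x y; set h := nm w.
have xh : `|x| <= h by exact: (Re_le_normc w).
have yh : `|y| <= h by exact: (Im_le_normc w).
have h0 : 0 <= h by exact: normc_ge0.
have eM : 0 <= expR M by exact: expR_ge0.
pose p : R := expR x - 1 - x - 2^-1 * x ^+ 2.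
pose q := expi y - Complex (1 - 2^-1 * y ^+ 2) y.
(* Replace e^(iy) by its quadratic polynomial with error [q], then e^x by its own with error [p].
   The last two terms are what the product of the two polynomials has in degrees 3 and 4. *)
have -> : cexp w - (1 + w + Complex 2^-1 0 * w ^+ 2) =
  Complex (expR x) 0 * q + Complex p 0 * Complex (1 - 2^-1 * y ^+ 2) y
  + (Complex 0 (2^-1 * x ^+ 2 * y)
     - Complex (x * (2^-1 * y ^+ 2) + 2^-1 * x ^+ 2 * (2^-1 * y ^+ 2)) 0).
  rewrite /q /cexp /expi expr2 /w; simpc.
  by congr Complex; rewrite /p; field.
have p3 : `|p| <= expR M * h ^+ 3.
  apply: le_trans (expR_taylor (le_trans xh wM)) _.
  by rewrite ler_wpM2l// lerXn2r.
have q3 : nm q <= 2 * h ^+ 3.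
  by apply: le_trans (expi_taylor y) _; rewrite ler_wpM2l// lerXn2r.
have x2 : x ^+ 2 <= h ^+ 2 by rewrite -(real_normK (num_real x)) lerXn2r.
have y2 : y ^+ 2 <= h ^+ 2 by rewrite -(real_normK (num_real y)) lerXn2r.
have h2M : h ^+ 2 <= M ^+ 2 by rewrite lerXn2r.
have hM : h <= M by [].
have T1 : nm (Complex (1 - 2^-1 * y ^+ 2) y) <= 1 + M + M ^+ 2.
  apply: le_trans (normc_le_ReIm _) _ => /=.
  have := ler_normB 1 (2^-1 * y ^+ 2); rewrite normr1.
  have y20 : 0 <= y ^+ 2 by exact: sqr_ge0.
  by rewrite [`|2^-1 * _|]ger0_norm; lra.
have x20 : 0 <= 2^-1 * x ^+ 2 by have := sqr_ge0 x; lra.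
have y20 : 0 <= 2^-1 * y ^+ 2 by have := sqr_ge0 y; lra.
have U : nm (Complex 0 (2^-1 * x ^+ 2 * y)) <= h ^+ 3.
  apply: le_trans (normc_le_ReIm _) _ => /=.
  rewrite normr0 add0r normrM ger0_norm//.
  by rewrite (exprSr h) ler_pM//; lra.
have V : nm (Complex (x * (2^-1 * y ^+ 2) + 2^-1 * x ^+ 2 * (2^-1 * y ^+ 2)) 0) <= h ^+ 3 * (1 + M).
  rewrite normc_real (_ : _ + _ = (x + 2^-1 * x ^+ 2) * (2^-1 * y ^+ 2)); last by ring.
  rewrite normrM [X in _ * X]ger0_norm//.
  rewrite (_ : h ^+ 3 * (1 + M) = (h + h * M) * h ^+ 2); last by ring.
  rewrite ler_pM//; last by lra.
  apply: le_trans (ler_normD _ _) _; rewrite lerD// ger0_norm//.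
  have : h ^+ 2 <= h * M by rewrite expr2 ler_wpM2l.
  by lra.
have ex : expR x <= expR M by rewrite ler_expR (le_trans (ler_norm _))// (le_trans xh).
have h3 : 0 <= h ^+ 3 by rewrite exprn_ge0.
have b1 : nm (Complex (expR x) 0 * q) <= expR M * (2 * h ^+ 3).
  rewrite Normc.normcM normc_real ger0_norm ?expR_ge0// ler_pM ?expR_ge0 ?normc_ge0//.
have b2 : nm (Complex p 0 * Complex (1 - 2^-1 * y ^+ 2) y) <= expR M * h ^+ 3 * (1 + M + M ^+ 2).
  by rewrite Normc.normcM normc_real ler_pM// normc_ge0.
apply: le_trans (normcD _ _) _.
apply: le_trans (lerD (normcD _ _) (normcB _ _)) _.
rewrite -/h; lra.
Qed.

(* Local expansion to second order in a complex variable, with a cubic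
   remainder; it is all that the maximum principle needs of holomorphy. *)
Definition taylor2 (f : R[i] -> R[i]) (z : R[i]) :=
  exists a b C, forall w, nm w <= 1 ->
    nm (f (z + w) - (f z + a * w + b * w ^+ 2)) <= C * nm w ^+ 3.

Lemma taylor2_ge0 f z : taylor2 f z ->
  exists a b C, 0 <= C /\ forall w, nm w <= 1 ->
    nm (f (z + w) - (f z + a * w + b * w ^+ 2)) <= C * nm w ^+ 3.
Proof.
move=> [a [b [C H]]]; exists a, b, C; split => //.
have := H 1; rewrite normc_1 !expr1n !mulr1 => /(_ (lexx _)).
exact: le_trans (normc_ge0 _).
Qed.

Lemma taylor2_cst (c : R[i]) z : taylor2 (fun _ => c) z.
Proof.
exists 0, 0, 0 => w _; rewrite !mul0r !addr0 subrr.
by rewrite (@normc_0 R).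
Qed.

Lemma taylor2D f g z : taylor2 f z -> taylor2 g z -> taylor2 (fun w => f w + g w) z.
Proof.
move=> [a [b [C H]]] [a' [b' [C' H']]]; exists (a + a'), (b + b'), (C + C') => w w1.
rewrite [leRHS]mulrDl (_ : _ - _ = (f (z + w) - (f z + a * w + b * w ^+ 2)) +
  (g (z + w) - (g z + a' * w + b' * w ^+ 2))); last by ring.
by apply: le_trans (normcD _ _) _; apply: lerD; [exact: H|exact: H'].
Qed.

Lemma taylor2M f g z : taylor2 f z -> taylor2 g z -> taylor2 (fun w => f w * g w) z.
Proof.
move=> /taylor2_ge0[a [b [C [C0 H]]]] /taylor2_ge0[a' [b' [C' [C'0 H']]]].
exists (f z * a' + a * g z), (f z * b' + a * a' + b * g z).
pose K := nm (f z) + nm a + nm b; pose K' := nm (g z) + nm a' + nm b'.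
exists (C * (K' + C') + K * C' + (nm a * nm b' + nm b * nm a' + nm b * nm b')) => w w1.
set r := f (z + w) - (f z + a * w + b * w ^+ 2).
set r' := g (z + w) - (g z + a' * w + b' * w ^+ 2).
set P := f z + a * w + b * w ^+ 2; set P' := g z + a' * w + b' * w ^+ 2.
(* The last term collects degrees 3 and 4 of [P * P']; since |w| <= 1, all three terms are cubic. *)
rewrite (_ : _ - _ = r * (P' + r') + P * r' +
    (a * b' + b * a' + b * b' * w) * w ^+ 3); last by rewrite /r /r' /P /P'; ring.
have h0 := normc_ge0 w; have h3 : 0 <= nm w ^+ 3 by rewrite exprn_ge0.
have h31 : nm w ^+ 3 <= 1 by rewrite exprn_ile1.
have h21 : nm w ^+ 2 <= 1 by rewrite exprn_ile1.
have Hr : nm r <= C * nm w ^+ 3 by exact: H.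
have Hr' : nm r' <= C' * nm w ^+ 3 by exact: H'.
have poly2 (u v t : R[i]) : nm (u + v * w + t * w ^+ 2) <= nm u + nm v + nm t.
  apply: le_trans (normcD _ _) _; apply: lerD.
    by apply: le_trans (normcD _ _) _; rewrite lerD2l Normc.normcM ler_piMr// normc_ge0.
  by rewrite Normc.normcM normcX ler_piMr// normc_ge0.
have HP : nm P <= K by exact: poly2.
have HP' : nm P' <= K' by exact: poly2.
have Hr'1 : nm r' <= C' by apply: le_trans Hr' _; rewrite ler_piMr.
apply: le_trans (normcD _ _) _; rewrite [leRHS]mulrDl; apply: lerD.
  apply: le_trans (normcD _ _) _; rewrite [leRHS]mulrDl; apply: lerD.
    rewrite Normc.normcM mulrAC ler_pM ?normc_ge0//.
    by apply: le_trans (normcD _ _) _; rewrite lerD.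
  by rewrite Normc.normcM -mulrA ler_pM ?normc_ge0.
rewrite Normc.normcM normcX ler_wpM2r//.
apply: le_trans (normcD _ _) _; apply: lerD.
  by apply: le_trans (normcD _ _) _; rewrite !Normc.normcM.
by rewrite !Normc.normcM ler_piMr// mulr_ge0 ?normc_ge0.
Qed.

Lemma taylor2_prod (I : Type) (r : seq I) (f : I -> R[i] -> R[i]) z :
  (forall i, taylor2 (f i) z) -> taylor2 (fun w => \prod_(i <- r) f i w) z.
Proof.
move=> H; elim: r => [|i r IH].
  rewrite [X in taylor2 X](_ : _ = fun=> 1); first exact: taylor2_cst.
  by apply/funext => w; rewrite big_nil.
rewrite [X in taylor2 X](_ : _ = fun w => f i w * \prod_(j <- r) f j w).
  exact: taylor2M.
by apply/funext => w; rewrite big_cons.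
Qed.

Lemma taylor2_sum (I : Type) (r : seq I) (f : I -> R[i] -> R[i]) z :
  (forall i, taylor2 (f i) z) -> taylor2 (fun w => \sum_(i <- r) f i w) z.
Proof.
move=> H; elim: r => [|i r IH].
  rewrite [X in taylor2 X](_ : _ = fun=> 0); first exact: taylor2_cst.
  by apply/funext => w; rewrite big_nil.
rewrite [X in taylor2 X](_ : _ = fun w => f i w + \sum_(j <- r) f j w).
  exact: taylor2D.
by apply/funext => w; rewrite big_cons.
Qed.

Lemma taylor2_cexp (u v z : R[i]) : taylor2 (fun w => cexp (u + v * w)) z.
Proof.
have [C H] := cexp_taylor (normc_ge0 v).
exists (cexp (u + v * z) * v), (cexp (u + v * z) * (Complex 2^-1 0 * v ^+ 2)).
exists (nm (cexp (u + v * z)) * (C * nm v ^+ 3)) => w w1.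
have vw : nm (v * w) <= nm v by rewrite Normc.normcM ler_piMr// normc_ge0.
have -> : cexp (u + v * (z + w)) = cexp (u + v * z) * cexp (v * w).
  by rewrite -cexpD mulrDr addrA.
rewrite (_ : _ - _ = cexp (u + v * z) *
  (cexp (v * w) - (1 + v * w + Complex 2^-1 0 * (v * w) ^+ 2))); last by ring.
rewrite Normc.normcM -mulrA ler_wpM2l ?normc_ge0//.
by rewrite -mulrA -exprMn -Normc.normcM; exact: H.
Qed.

Lemma taylor2_lip f z : taylor2 f z -> exists2 C, 0 <= C &
  forall w, nm w <= 1 -> nm (f (z + w) - f z) <= C * nm w.
Proof.
move=> /taylor2_ge0[a [b [C [C0 H]]]]; exists (C + nm a + nm b).
  by rewrite !addr_ge0 ?normc_ge0.
move=> w w1; have h0 := normc_ge0 w.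
rewrite (_ : _ - _ = (f (z + w) - (f z + a * w + b * w ^+ 2)) + a * w + b * w ^+ 2); last by ring.
apply: le_trans (normcD _ _) _; rewrite [leRHS]mulrDl; apply: lerD.
  apply: le_trans (normcD _ _) _; rewrite [leRHS]mulrDl; apply: lerD.
    apply: le_trans (H _ w1) _; rewrite ler_wpM2l//.
    by rewrite exprS ler_piMr// exprn_ile1.
  by rewrite Normc.normcM.
by rewrite Normc.normcM normcX ler_wpM2l ?normc_ge0// expr2 ler_piMr.
Qed.

(* Averaging over w, iw, -w, -iw kills the first and second order terms. *)
Lemma taylor2_average f z : taylor2 f z -> exists C, forall h : R, 0 <= h <= 1 ->
  nm (f z) <= 4^-1 * (nm (f (z + Complex h 0)) + nm (f (z + Complex 0 h))
    + nm (f (z + Complex (- h) 0)) + nm (f (z + Complex 0 (- h)))) + C * h ^+ 3.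
Proof.
move=> [a [b [C H]]]; exists C => h /andP[h0 h1].
pose r w := f (z + w) - (f z + a * w + b * w ^+ 2).
have e : f z *+ 4 = f (z + Complex h 0) + f (z + Complex 0 h)
    + f (z + Complex (- h) 0) + f (z + Complex 0 (- h))
    - (r (Complex h 0) + r (Complex 0 h) + r (Complex (- h) 0) + r (Complex 0 (- h))).
  rewrite /r.
  have e1 : Complex (- h) 0 = - Complex h 0 by simpc.
  have e2 : Complex 0 (- h) = - Complex 0 h by simpc.
  have e3 : Complex 0 h ^+ 2 = - Complex h 0 ^+ 2 by rewrite !expr2; simpc.
  rewrite e1 e2 !sqrrN e3; ring.
have rC w : nm w = h -> nm (r w) <= C * h ^+ 3.
  by move=> wh; rewrite -wh; apply: H; rewrite wh.
have n1 : nm (Complex h 0) = h by rewrite normc_real ger0_norm.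
have n2 : nm (Complex 0 h) = h by rewrite /= expr0n/= add0r sqrtr_sqr ger0_norm.
have n3 : nm (Complex (- h) 0) = h by rewrite normc_real normrN ger0_norm.
have n4 : nm (Complex 0 (- h)) = h by rewrite /= expr0n/= add0r sqrtr_sqr normrN ger0_norm.
have : nm (f z) *+ 4 <= nm (f (z + Complex h 0)) + nm (f (z + Complex 0 h))
    + nm (f (z + Complex (- h) 0)) + nm (f (z + Complex 0 (- h))) + 4 * (C * h ^+ 3).
  rewrite -[X in X <= _](@normcMn R (f z) 4) e.
  apply: le_trans (normcB _ _) _; apply: lerD.
    apply: le_trans (normcD _ _) _; rewrite lerD2r.
    by apply: le_trans (normcD _ _) _; rewrite lerD2r normcD.
  have := rC _ n1; have := rC _ n2; have := rC _ n3; have := rC _ n4.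
  have := normcD (r (Complex h 0) + r (Complex 0 h) + r (Complex (- h) 0)) (r (Complex 0 (- h))).
  have := normcD (r (Complex h 0) + r (Complex 0 h)) (r (Complex (- h) 0)).
  have := normcD (r (Complex h 0)) (r (Complex 0 h)).
  lra.
rewrite -mulr_natl; lra.
Qed.

End Taylor.

(** * Maximum principle *)

Section MaximumPrinciple.
Context {R : realType}.
Local Notation nm := (@Normc.normc R).
Implicit Types (z w : R[i]).

Definition C_of (p : R * R) : R[i] := Complex p.1 p.2.

Lemma continuous_of_lip (g : R * R -> R) (p : R * R) (C : R) : 0 <= C ->
  (forall q, `|q.1 - p.1| <= 2^-1 -> `|q.2 - p.2| <= 2^-1 ->
    `|g q - g p| <= C * (`|q.1 - p.1| + `|q.2 - p.2|)) ->
  {for p, continuous g}.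
Proof.
move=> C0 H; apply/cvgrPdist_lt => e e0.
pose r := Num.min 2^-1 (e / (2 * (C + 1))).
have C1 : 0 < 2 * (C + 1) by lra.
have r0 : 0 < r by rewrite lt_min invr_gt0 ltr0n divr_gt0.
have : \forall q \near p, ball p r q by exact: nbhsx_ballx.
apply: filterS => q [/= b1 b2].
have {b1} : `|q.1 - p.1| < r by rewrite distrC.
have {b2} : `|q.2 - p.2| < r by rewrite distrC.
have [rh re] : r <= 2^-1 /\ r <= e / (2 * (C + 1)).
  by rewrite /r !ge_min !lexx orbT.
move=> b2 b1; rewrite distrC.
apply: le_lt_trans (H q _ _) _; [lra|lra|].
move: re; rewrite ler_pdivlMr// => re.
have : C * (`|q.1 - p.1| + `|q.2 - p.2|) <= C * (2 * r) by rewrite ler_wpM2l//; lra.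
by lra.
Qed.

Lemma taylor2_continuous (f : R[i] -> R[i]) : (forall z, taylor2 f z) ->
  continuous (fun p : R * R => nm (f (C_of p))).
Proof.
move=> H p; have [C C0 lipf] := taylor2_lip (H (C_of p)).
apply: (@continuous_of_lip _ _ C) => // q q1 q2.
have w1 : nm (C_of q - C_of p) <= `|q.1 - p.1| + `|q.2 - p.2|.
  exact: normc_le_ReIm.
have := lipf (C_of q - C_of p); rewrite [_ + (_ - _)]addrC subrK => lip.
have {}lip : nm (f (C_of q) - f (C_of p)) <= C * nm (C_of q - C_of p).
  by apply: lip; lra.
apply: (@le_trans _ _ (nm (f (C_of q) - f (C_of p)))); last first.
  by apply: le_trans lip _; rewrite ler_wpM2l.
rewrite ler_norml; apply/andP; split.
  by have := normcD (f (C_of p) - f (C_of q)) (f (C_of q)); rewrite subrK normc_distC; lra.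
by have := normcD (f (C_of q) - f (C_of p)) (f (C_of p)); rewrite subrK; lra.
Qed.

Lemma taylor2_id z : taylor2 (fun w : R[i] => w) z.
Proof.
exists 1, 0, 0 => w _; rewrite mul1r mul0r addr0 subrr mul0r.
by rewrite (@normc_0 R).
Qed.

(** Instead of boundary and interior, each point of [Om] either satisfies the bound or has room in
    the four axis directions. Adding eta |z|^2 makes the four-point average exceed the central value
    by eta h^2 up to an error of order h^3, so a maximum can only occur at a point of the first
    kind; then eta tends to 0. *)
Lemma maximum_principle (f : R[i] -> R[i]) (Om : set (R * R)) (D B : R) :
  (forall z, taylor2 f z) -> compact Om -> Om (0, 0) ->
  (forall p, Om p -> nm (C_of p) ^+ 2 <= D) ->
  (forall p, Om p -> nm (f (C_of p)) <= B \/
     exists2 h0 : R, 0 < h0 & forall h, 0 <= h <= h0 ->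
       [/\ Om (p.1 + h, p.2), Om (p.1, p.2 + h), Om (p.1 - h, p.2)
         & Om (p.1, p.2 - h)]) ->
  nm (f 0) <= B.
Proof.
move=> tf cO O0 OD Hb.
suff key (eta : R) : 0 < eta -> nm (f 0) <= B + eta * D.
  have D0 : 0 <= D by apply: le_trans (OD _ O0); rewrite sqr_ge0.
  apply/ler_addgt0Pr => e e0.
  have D1 : 0 < D + 1 by lra.
  have := key (e / (D + 1)) (divr_gt0 e0 D1).
  suff : e / (D + 1) * D <= e by lra.
  by rewrite mulrAC ler_pdivrMr// ler_wpM2l ?(ltW e0)//; lra.
move=> eta0.
(* |z|^2 is written as the modulus of z z so that its continuity is an instance of
   [taylor2_continuous]. *)
pose v (p : R * R) := nm (f (C_of p)) + eta * nm (C_of p * C_of p).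
have cv : continuous v.
  move=> p; apply: cvgD; first exact: taylor2_continuous.
  apply: cvgM; first exact: cvg_cst.
  apply: (@taylor2_continuous (fun w => w * w)) => z.
  by apply: taylor2M; exact: taylor2_id.
have [p pO vp] := compact_EVT_max (ex_intro _ _ O0) cO (continuous_subspaceT cv).
rewrite inE in pO.
have {}vp q : Om q -> v q <= v p by move=> Oq; apply: vp; rewrite inE.
have v0 : nm (f 0) <= v (0, 0).
  by rewrite /v lerDl; apply: mulr_ge0; [exact: ltW|exact: normc_ge0].
case: (Hb p pO) => [fp|[h0 h00 Hh]].
  apply: le_trans v0 _; apply: le_trans (vp _ O0) _; rewrite /v lerD// ler_wpM2l ?(ltW eta0)//.
  by rewrite Normc.normcM -expr2; exact: OD.
have [C HC] := taylor2_average (tf (C_of p)).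
exfalso.
(* The last bound makes the error C h^3 at most half of the gain eta h^2. *)
pose h := Num.min (Num.min h0 1) (eta / (2 * (`|C| + 1))).
have C1 : 0 < 2 * (`|C| + 1) by have := normr_ge0 C; lra.
have hgt0 : 0 < h by rewrite !lt_min h00 ltr01 divr_gt0.
have [hh0 h1 he] : [/\ h <= h0, h <= 1 & h <= eta / (2 * (`|C| + 1))].
  by rewrite /h !ge_min !lexx !orbT.
have [|O1 O2 O3 O4] := Hh h; first by rewrite ltW.
have := HC h; rewrite ltW// h1 => /(_ isT).
have := vp _ O1; have := vp _ O2; have := vp _ O3; have := vp _ O4.
rewrite /v !Normc.normcM -!expr2 !normc_sqr /C_of /=.
case: (p) => x y /=; simpc.
move: he; rewrite ler_pdivlMr// => he.
have : C * h ^+ 3 <= 2^-1 * eta * h ^+ 2.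
  rewrite exprS mulrA ler_wpM2r ?sqr_ge0//.
  have : C * h <= `|C| * h by rewrite ler_wpM2r ?(ltW hgt0)// ler_norm.
  lra.
have : 0 < eta * h ^+ 2 by rewrite mulr_gt0// exprn_gt0.
lra.
Qed.

End MaximumPrinciple.

(** * Exponential sums bounded below through a regular polygon *)

Section Polygon.
Context {R : realType}.
Local Notation nm := (@Normc.normc R).
Implicit Types (z w : R[i]).

Lemma taylor2_affine (f : R[i] -> R[i]) (u v z : R[i]) : nm v <= 1 ->
  taylor2 f (u + v * z) -> taylor2 (fun w => f (u + v * w)) z.
Proof.
move=> v1 /taylor2_ge0[a [b [C [C0 H]]]]; exists (a * v), (b * v ^+ 2), C => w w1.
have vw : nm (v * w) <= nm w by rewrite Normc.normcM ler_piMl// normc_ge0.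
rewrite mulrDr addrA -(mulrA a) -(mulrA b) -exprMn.
apply: le_trans (H _ (le_trans vw w1)) _.
by rewrite ler_wpM2l// lerXn2r// nnegrE normc_ge0.
Qed.

Lemma finite_pos_lbound (g : nat -> R) (m : nat) :
  (forall k, (k < m)%N -> 0 < g k) ->
  exists2 h, 0 < h & forall k, (k < m)%N -> h <= g k.
Proof.
elim: m => [|m IH] H; first by exists 1.
have [k km|h h0 Hh] := IH; first by apply: H; rewrite ltnW.
exists (Num.min h (g m)); first by rewrite lt_min h0 H.
by move=> k; rewrite ltnS leq_eqVlt ge_min => /orP[/eqP ->|/Hh ->//]; rewrite lexx orbT.
Qed.

(* The regular 4j-gon with inradius d, seen as the set of z whose rotates
   w^k z all lie in the half-plane Re >= - d. *)
Definition polygon (w : R[i]) (d : R) : set (R * R) :=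
  [set p | forall k, - d <= complex.Re (w ^+ k * C_of p)].

Lemma closed_polygon w d : closed (polygon w d).
Proof.
rewrite (_ : polygon w d = \bigcap_(k in [set: nat])
    [set p | - d <= complex.Re (w ^+ k * C_of p)]); last first.
  by apply/seteqP; split=> [p Hp k _|p Hp k]; [exact: Hp|exact: (Hp k)].
apply: closed_bigI => k _.
pose g (p : R * R) := complex.Re (w ^+ k * C_of p).
have cg : continuous g.
  rewrite (_ : g = fun p => complex.Re (w ^+ k) * p.1 - complex.Im (w ^+ k) * p.2).
    move=> p; apply: cvgB; apply: cvgM; [exact: cvg_cst|exact: cvg_fst|exact: cvg_cst|exact: cvg_snd].
  by apply/funext => -[x y]; rewrite /g; case: (w ^+ k) => a b.
rewrite (_ : [set p | _] = g @^-1` [set y | - d <= y])//.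
by apply: closed_comp => //; exact: closed_ge.
Qed.

Variables (F : R[i] -> R[i]) (K L eps d : R) (j : nat).
Hypotheses (tF : forall z, taylor2 F z) (d0 : 0 < d) (j0 : (0 < j)%N).
Hypothesis FK : forall z, 0 <= complex.Re z -> nm (F z) <= K.
Hypothesis Feps : forall t, 0 <= t <= L -> nm (F (Complex 0 t)) <= eps.

(** Half the angle under which an edge is seen from the centre. With 4j sides, w^j = i, so the four
    axis directions are among the constraints and the polygon lies in a square of half-side d. Half
    an edge has length d tan b; [dL] says that it is at most L / 2. *)
Let b : R := pi / 4 / j%:R.
Let w : R[i] := expi (b *+ 2).

Hypothesis dL : d * sin b <= L / 2 * cos b.

Let b_gt0 : 0 < b.
Proof. by rewrite /b !divr_gt0 ?pi_gt0 ?ltr0n. Qed.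

Let b_lt : b < pi / 2.
Proof.
rewrite /b ltr_pdivrMr ?ltr0n//.
have j1 : 1 <= j%:R :> R by rewrite ler1n.
have := @pi_gt0 R => p0.
by apply: (@lt_le_trans _ _ (pi / 2)); [lra|rewrite ler_peMr//; lra].
Qed.

Let w_j : w ^+ j = Complex 0 1.
Proof.
rewrite /w -expiMn -mulrnA (_ : b *+ (2 * j) = pi / 2).
  by rewrite /expi cos_pihalf sin_pihalf.
by rewrite -(mulr_natr b) natrM /b; field; rewrite pnatr_eq0 -lt0n.
Qed.

Let w_m : w ^+ (4 * j) = 1.
Proof.
rewrite mulnC exprM w_j (_ : Complex 0 1 ^+ 4 = (Complex 0 1 * Complex 0 1) ^+ 2); last first.
  by rewrite -expr2 -exprM.
by simpc; rewrite (_ : Complex (-1) 0 = -1 :> R[i]) ?sqrrN ?expr1n//; simpc.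
Qed.

Let nm_w k : nm (w ^+ k) = 1.
Proof. by rewrite normcX normc_expi expr1n. Qed.

Let polygon_lt_mul p : (forall k, (k < 4 * j)%N -> - d <= complex.Re (w ^+ k * C_of p)) ->
  polygon w d p.
Proof.
move=> H k; rewrite -(expr_mod k w_m); apply: H; rewrite ltn_mod.
by rewrite muln_gt0.
Qed.

Let polygon_box p : polygon w d p -> `|p.1| <= d /\ `|p.2| <= d.
Proof.
move=> H; have := H 0%N; have := H j; have := H (j + j)%N; have := H (j + (j + j))%N.
rewrite !exprD w_j expr0; case: p {H} => x y /=; simpc => /=.
by move=> *; rewrite !ler_norml; split; lra.
Qed.

Let compact_polygon : compact (polygon w d).
Proof.
apply: (@subclosed_compact _ _ (`[- d, d] `*` `[- d, d])).
- exact: closed_polygon.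
- by apply: compact_setX; exact: segment_compact.
- move=> p /polygon_box[]; rewrite !ler_norml => p1 p2.
  by split; rewrite /= in_itv.
Qed.

(** An edge is cut off by the two adjacent half-planes. At -d + iy they read y sin 2b <= d (1 - cos
    2b) and the same for -y, that is |y| <= d tan b. The index k - 1 is represented by k + (4j -
    1). *)
Let polygon_edge p k : polygon w d p -> complex.Re (w ^+ k * C_of p) = - d ->
  `|complex.Im (w ^+ k * C_of p)| <= L / 2.
Proof.
move=> H e; set u := w ^+ k * C_of p in e *.
have := H k.+1; have := H (k + (4 * j).-1)%N.
have -> : w ^+ (k + (4 * j).-1) = expi (- (b *+ 2)) * w ^+ k.
  rewrite exprD mulrC; congr (_ * _).
  rewrite -[LHS]mul1r -expi0 -(addNr (b *+ 2)) expiD -mulrA -exprS prednK ?muln_gt0 ?j0//.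
  by rewrite w_m mulr1.
rewrite exprS -!mulrA -/u /w.
have sb : 0 < sin b by apply: sin_gt0_pihalf; rewrite b_gt0.
have cb : 0 < cos b.
  by apply: cos_gt0_pihalf; rewrite b_lt andbT (lt_trans _ b_gt0)// oppr_lt0 divr_gt0 ?pi_gt0.
have s2 : sin (b *+ 2) = 2 * cos b * sin b by rewrite sin_mulr2n; ring.
have c2 : cos (b *+ 2) = 1 - 2 * sin b ^+ 2.
  by rewrite cos_mulr2n cos2sin2; ring.
case: u e => x y /= ->; rewrite /expi cosN sinN s2 c2; simpc => /= h1 h2.
have k1 : y * cos b <= d * sin b.
  by rewrite -(ler_pM2r sb) -(ler_pM2l (ltr0n R 2)); move: h1 h2; lra.
have k2 : - y * cos b <= d * sin b.
  by rewrite -(ler_pM2r sb) -(ler_pM2l (ltr0n R 2)); move: h1 h2; lra.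
have y1 : y <= L / 2 by rewrite -(ler_pM2r cb) (le_trans k1).
have y2 : - y <= L / 2 by rewrite -(ler_pM2r cb) (le_trans k2).
by rewrite ler_norml; apply/andP; split; lra.
Qed.

(** At the centre all factors of [P] equal F(c). On the polygon every factor is at most K, because c
    + w^k z stays in Re >= 0; on the k-th edge this point lies in i[0, L], so that one factor is at
    most eps. *)
Lemma polygon_bound : nm (F (Complex d (L / 2))) ^+ (4 * j) <= eps * K ^+ (4 * j).-1.
Proof.
pose c := Complex d (L / 2).
pose P z := \prod_(k < 4 * j) F (c + w ^+ k * z).
have tP z : taylor2 P z.
  apply: taylor2_prod => k; apply: taylor2_affine; last exact: tF.
  by rewrite nm_w.
have P0 : P 0 = F c ^+ (4 * j).
  rewrite /P (eq_bigr (fun=> F c)) => [|k _]; last by rewrite mulr0 addr0.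
  by rewrite prodr_const card_ord.
rewrite -normcX -P0; apply: (maximum_principle tP compact_polygon (D := d ^+ 2 + d ^+ 2)).
- move=> k; by rewrite (_ : C_of (0, 0) = 0)// mulr0 oppr_le0 ltW.
- move=> p /polygon_box[p1 p2]; rewrite normc_sqr/=.
  rewrite -(real_normK (num_real p.1)) -(real_normK (num_real p.2)).
  by apply: lerD; rewrite lerXn2r// nnegrE ltW.
move=> p Hp.
have Fk k : nm (F (c + w ^+ k * C_of p)) <= K.
  apply: FK; rewrite ReD /=; have := Hp k; lra.
have [[k [km ek]]|noedge] := pselect (exists k, (k < 4 * j)%N /\ complex.Re (w ^+ k * C_of p) = - d).
  left; rewrite /P normc_prod (bigD1 (Ordinal km))//=.
  apply: ler_pM; rewrite ?normc_ge0//.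
  - by apply: prodr_ge0 => i _; exact: normc_ge0.
  - have := polygon_edge Hp ek; move: ek.
    case: (w ^+ k * C_of p) => x y /= ->; rewrite ler_norml => yL.
    rewrite (_ : c + _ = Complex 0 (L / 2 + y)); last by rewrite /c; simpc.
    by apply: Feps; lra.
  - apply: (@le_trans _ _ (\prod_(i < 4 * j | i != Ordinal km) K)).
      by apply: ler_prod => i _; rewrite normc_ge0 Fk.
    by rewrite prodr_const cardC1 card_ord.
right.
(* Off the edges the finitely many constraints are strict. [h0] is a lower bound for their slack,
   and a shift of length h moves each real part by at most h. *)
have [k km|h0 h00 Hh] := @finite_pos_lbound
  (fun k => complex.Re (w ^+ k * C_of p) + d) (4 * j).
  rewrite -[X in X < _](addNr d) ltrD2r lt_neqAle Hp andbT eq_sym.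
  by apply/eqP => e; apply: noedge; exists k.
exists h0 => // h /andP[hge0 hh0].
have shift u : nm u = h -> forall k, (k < 4 * j)%N -> - d <= complex.Re (w ^+ k * (C_of p + u)).
  move=> uh k km; rewrite mulrDr ReD.
  have := Hh _ km; have := Re_le_normc (w ^+ k * u).
  by rewrite Normc.normcM nm_w mul1r uh ler_norml; lra.
have n1 : nm (Complex h 0) = h by rewrite normc_real ger0_norm.
have n2 : nm (Complex 0 h) = h by rewrite /= expr0n/= add0r sqrtr_sqr ger0_norm.
have n3 : nm (Complex (- h) 0) = h by rewrite normc_real normrN ger0_norm.
have n4 : nm (Complex 0 (- h)) = h by rewrite /= expr0n/= add0r sqrtr_sqr normrN ger0_norm.
have e1 : C_of (p.1 + h, p.2) = C_of p + Complex h 0 by rewrite /C_of; simpc.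
have e2 : C_of (p.1, p.2 + h) = C_of p + Complex 0 h by rewrite /C_of; simpc.
have e3 : C_of (p.1 - h, p.2) = C_of p + Complex (- h) 0 by rewrite /C_of; simpc.
have e4 : C_of (p.1, p.2 - h) = C_of p + Complex 0 (- h) by rewrite /C_of; simpc.
by split; apply: polygon_lt_mul; rewrite ?e1 ?e2 ?e3 ?e4; exact: shift.
Qed.

End Polygon.

Section ExponentialSums.
Context {R : realType}.
Local Notation nm := (@Normc.normc R).

Definition expsum (lam : nat -> R) (N : nat) (c : nat -> R[i]) (z : R[i]) : R[i] :=
  \sum_(0 <= n < N.+1) c n * cexp (Complex (- lam n) 0 * z).

Lemma taylor2_expsum lam N c z : taylor2 (expsum lam N c) z.
Proof.
apply: taylor2_sum => n; apply: taylor2M; first exact: taylor2_cst.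
have := taylor2_cexp 0 (Complex (- lam n) 0) z.
by under eq_fun do rewrite add0r.
Qed.

Lemma normc_cexp_real (x : R) z : nm (cexp (Complex x 0 * z)) = expR (x * complex.Re z).
Proof. by rewrite normc_cexp; case: z => a b /=; rewrite mul0r subr0. Qed.

(** The inradius d depends on [K] and [l1] only, and j on d and L only, so [delta] serves all sums
    at once. *)
Lemma expsum_lower_bound (l1 K L : R) : 0 < l1 -> 1 <= K -> 0 < L ->
  exists2 delta : R, 0 < delta & forall lam N c,
    lam 0%N = 0 -> (forall n, (1 <= n)%N -> l1 <= lam n) -> c 0%N = 1 ->
    \sum_(0 <= n < N.+1) nm (c n) <= K ->
    forall eps, (forall t, 0 <= t <= L -> nm (expsum lam N c (Complex 0 t)) <= eps) ->
    delta <= eps.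
Proof.
move=> l10 K1 L0.
(* At abscissa d the terms n >= 1 add up to at most K e^(-2K) <= K / (1 + 2K) <= 1/2, against the
   constant term 1. *)
pose d := 2 * K / l1.
have d0 : 0 < d by rewrite /d divr_gt0//; lra.
have [j j0 dj] : exists2 j, (0 < j)%N & d * sin (pi / 4 / j%:R) <= L / 2 * cos (pi / 4 / j%:R).
  (* Since b j = pi / 4 <= 1, j >= x gives b <= 1/2 and 4 b d <= L. Then d sin b <= d b <= L / 4 <=
     (L / 2)(1 - b) <= (L / 2) cos b. *)
  pose x := 2 + 4 * d / L.
  have x0 : 0 <= 4 * d / L by rewrite divr_ge0//; lra.
  have [j xj] : exists j, x <= j%:R by exists (Num.truncn x).+1; rewrite ltW// truncnS_gt.
  have j0 : 0 < j%:R :> R by apply: lt_le_trans xj; rewrite /x; lra.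
  exists j; first by rewrite ltr0n in j0.
  set b := pi / 4 / j%:R.
  have p4 : pi <= 4 :> R by have := @pihalf_lt2 R; lra.
  have b0 : 0 < b by rewrite /b !divr_gt0 ?pi_gt0.
  have bj : b * j%:R <= 1 by rewrite /b divfK ?gt_eqF//; lra.
  have b2 : b * 2 <= 1 by apply: le_trans bj; rewrite ler_wpM2l ?(ltW b0)//; rewrite /x in xj; lra.
  have bd : b * (4 * d / L) <= 1 by apply: le_trans bj; rewrite ler_wpM2l ?(ltW b0)//; rewrite /x in xj; lra.
  have {}bd : 4 * (b * d) <= L by move: bd; rewrite mulrA ler_pdivrMr//; lra.
  have := @sin_le_pow _ 1 b isT; have := @cos_taylor1 _ 0 b isT.
  rewrite !expr1 (ger0_norm (ltW b0)) !ler_norml => /andP[cb _] /andP[_ sb].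
  have : d * sin b <= d * b by rewrite ler_wpM2l ?(ltW d0)//; lra.
  have : L / 2 * (1 - b) <= L / 2 * cos b by rewrite ler_wpM2l//; lra.
  have : L * (b * 2) <= L by rewrite ler_piMr// ltW.
  lra.
exists ((2^-1) ^+ (4 * j) / K ^+ (4 * j).-1).
  by rewrite divr_gt0// exprn_gt0; lra.
move=> lam N c lam0 lam1 c0 cK eps Heps.
have lamge0 n : 0 <= lam n.
  by case: n => [|n]; [rewrite lam0|apply: le_trans (lam1 n.+1 isT); exact: ltW].
have FK z : 0 <= complex.Re z -> nm (expsum lam N c z) <= K.
  move=> z0; apply: le_trans cK; apply: le_trans (normc_sum _ _ _) _.
  apply: ler_sum => n _; rewrite Normc.normcM normc_cexp_real ler_piMr ?normc_ge0//.
  by rewrite -expR0 ler_expR mulNr oppr_le0 mulr_ge0.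
have := polygon_bound (taylor2_expsum lam N c) d0 j0 FK Heps dj.
rewrite ler_pdivrMr ?exprn_gt0//; last by lra.
apply: le_trans; rewrite lerXn2r// ?nnegrE ?normc_ge0//.
rewrite /expsum big_nat_recl// lam0 c0 mul1r oppr0.
have -> : cexp (Complex 0 0 * Complex d (L / 2)) = 1.
  by simpc; rewrite /cexp /= expR0 expi0 mulr1.
apply: le_trans (normcDB _ _); rewrite normc_1.
suff : nm (\sum_(0 <= i < N) c i.+1 * cexp (Complex (- lam i.+1) 0 * Complex d (L / 2))) <= 2^-1.
  lra.
apply: le_trans (normc_sum _ _ _) _.
apply: (@le_trans _ _ (\sum_(0 <= i < N) nm (c i.+1) * expR (- (2 * K)))).
  apply: ler_sum => n _; rewrite Normc.normcM normc_cexp_real ler_wpM2l ?normc_ge0//.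
  rewrite ler_expR/= mulNr lerN2.
  have -> : 2 * K = l1 * d by rewrite /d; field; rewrite gt_eqF.
  by rewrite ler_wpM2r ?lam1// ltW.
rewrite -mulr_suml expRN ler_pdivrMr ?expR_gt0//.
have := expR_ge1Dx (2 * K).
move: cK; rewrite big_nat_recl// c0 normc_1; lra.
Qed.

End ExponentialSums.

(** * Moving averages *)

Section Averages.
Context {R : realType}.
Local Notation nm := (@Normc.normc R).
Local Notation mu := (@lebesgue_measure R).

Lemma cexp_im (l t : R) : cexp (Complex (- l) 0 * Complex 0 t) = expi (- (l * t)).
Proof. by simpc; rewrite /cexp/= expR0 mul1r. Qed.

Lemma continuous_expsum lam N c :
  continuous (fun t : R => nm (expsum lam N c (Complex 0 t))).
Proof.
move=> t; apply: (@continuous_comp _ _ _ (fun t : R => (0, t))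
  (fun p : R * R => nm (expsum lam N c (C_of p)))).
  rewrite /prop_for /continuous_at; apply: (@cvg_pair _ _ _ (nbhs t) (nbhs (0 : R)) (nbhs t)
    _ _ _ (fun=> 0) id); [exact: cvg_cst|exact: cvg_id].
by apply: taylor2_continuous => z; exact: taylor2_expsum.
Qed.

(* [(1/h) \int_s^(s+h) e^{-i l t} dt = sincc (l h) e^{-i l s}] *)
Definition sincc (x : R) : R[i] :=
  if x == 0 then 1 else Complex (sin x / x) ((cos x - 1) / x).

Lemma sincc0 : sincc 0 = 1.
Proof. by rewrite /sincc eqxx. Qed.

(** This is |e^(-ix) - 1| = 2 |sin (x / 2)|. It yields both the bound 1, so that averaging never
    enlarges a coefficient, and the decay 2 / |x|. *)
Lemma normc_sincc (x : R) : x != 0 -> nm (sincc x) = 2 * `|sin (x / 2)| / `|x|.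
Proof.
move=> x0; apply/eqP.
rewrite -(@eqrXn2 _ 2)// ?normc_ge0 ?divr_ge0 ?mulr_ge0// normc_sqr /sincc (negbTE x0) /=.
rewrite !exprMn !exprVn -!normrX !(ger0_norm (sqr_ge0 _)) -mulrDl; apply/eqP; congr (_ / _).
have -> : x = (x / 2) *+ 2 by rewrite -mulr_natr divfK.
rewrite (_ : x / 2 *+ 2 / 2 = x / 2); last by rewrite -[_ *+ 2]mulr_natr mulfK.
rewrite sin_mulr2n cos_mulr2n; set c := cos _; set s := sin _.
have c2 : c ^+ 2 = 1 - s ^+ 2 by exact: cos2sin2.
rewrite (_ : _ + _ = 4 * c ^+ 2 * s ^+ 2 + (2 * c ^+ 2 - 2) ^+ 2); last by ring.
by rewrite c2; ring.
Qed.

Lemma normc_sincc_le1 (x : R) : nm (sincc x) <= 1.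
Proof.
have [->|x0] := eqVneq x 0; first by rewrite sincc0 normc_1.
rewrite normc_sincc// ler_pdivrMr ?normr_gt0// mul1r.
have := @sin_le_pow _ 1 (x / 2) isT.
by rewrite expr1 normrM (@ger0_norm _ 2^-1)//; lra.
Qed.

Lemma normc_sincc_le (x : R) : x != 0 -> nm (sincc x) <= 2 / `|x|.
Proof.
move=> x0; rewrite normc_sincc// ler_wpM2r ?invr_ge0//.
by have := sin_max (x / 2); lra.
Qed.

(** Taking real parts keeps the primitive a real function. The value [sincc 0 = 1] lets the
    frequency 0 obey the same formula. *)
Lemma sincc_primitive (a : R[i]) (l : R) : exists G : R -> R,
  (forall t : R, is_derive t (1 : R) G (complex.Re (a * expi (- (l * t))))) /\
  forall s h, 0 < h ->
    G (s + h) - G s = h * complex.Re (a * sincc (l * h) * expi (- (l * s))).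
Proof.
have [->|l0] := eqVneq l 0.
  exists (fun t => complex.Re a * t); split=> [t|s h h0].
    rewrite mul0r oppr0 expi0 mulr1.
    have -> : (fun t => complex.Re a * t) = complex.Re a \*: (@idfun R) by [].
    by apply: is_derive_eq; rewrite /GRing.scale/= mulr1.
  by rewrite !mul0r oppr0 expi0 sincc0 !mulr1; ring.
pose S t := sin (l * t); pose C t := cos (l * t).
have dl (t : R) : is_derive t (1 : R) (fun t => l * t) l.
  have -> : (fun t => l * t) = l \*: (@idfun R) by [].
  by apply: is_derive_eq; rewrite /GRing.scale/= mulr1.
have dS (t : R) : is_derive t (1 : R) S (cos (l * t) * l).
  exact: (is_derive1_comp (f := @sin R)).
have dC (t : R) : is_derive t (1 : R) C (- sin (l * t) * l).
  exact: (is_derive1_comp (f := @cos R)).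
exists (fun t => complex.Re a / l * S t - complex.Im a / l * C t); split=> [t|s h h0].
  have := is_deriveB (is_deriveZ (complex.Re a / l) (dS t)) (is_deriveZ (complex.Im a / l) (dC t)).
  move=> D; apply: (is_derive_eq D); rewrite /GRing.scale/=.
  by rewrite /expi cosN sinN; case: (a) => x y; simpc => /=; field.
rewrite /S /C mulrDr sinD cosD /sincc mulf_eq0 (negbTE l0) (gt_eqF h0) /=.
rewrite /expi cosN sinN; case: (a) => x y; simpc => /=; field.
by rewrite l0 gt_eqF.
Qed.

Lemma is_derive_bigsum (n : nat) (f df : nat -> R -> R) (t : R) :
  (forall i, is_derive t (1 : R) (f i) (df i t)) ->
  is_derive t (1 : R) (fun t => \sum_(0 <= i < n) f i t) (\sum_(0 <= i < n) df i t).
Proof.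
move=> H; elim: n => [|n IH].
  rewrite big_nil (_ : (fun _ => _) = cst 0); first exact: is_derive_cst.
  by apply/funext => u; rewrite big_nil.
rewrite big_nat_recr//= (_ : (fun _ => _) = (fun u => \sum_(0 <= i < n) f i u) + f n).
  exact: is_deriveD.
by apply/funext => u; rewrite big_nat_recr.
Qed.

(** The coefficients of the moving average (1/h) \int_t^(t+h) f of the sum f with coefficients
    [c]. *)
Definition avg (lam : nat -> R) (h : R) (c : nat -> R[i]) (n : nat) : R[i] :=
  c n * sincc (lam n * h).

(** Rotate by the unit u that makes the averaged sum at s nonnegative, and let G be a primitive of
    Re (u f). As u depends on s, so does G. The mean value theorem on G gives [avg_sup], the
    fundamental theorem of calculus gives [avg_L1]. *)
Lemma expsum_avg_primitive lam N c h s : 0 < h -> exists G dG : R -> R,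
  [/\ forall t : R, is_derive t (1 : R) G (dG t),
      continuous dG,
      forall t, dG t <= nm (expsum lam N c (Complex 0 t)) &
      G (s + h) - G s = h * nm (expsum lam N (avg lam h c) (Complex 0 s))].
Proof.
move=> h0; have [u u1 uE] := normc_dual (expsum lam N (avg lam h c) (Complex 0 s)).
have [G HG] := choice (fun n => sincc_primitive (u * c n) (lam n)).
pose g n t := complex.Re (u * c n * expi (- (lam n * t))).
exists (fun t => \sum_(0 <= n < N.+1) G n t), (fun t => \sum_(0 <= n < N.+1) g n t).
split.
- by move=> t; apply: (@is_derive_bigsum _ G g) => i; exact: (HG i).1.
- rewrite (_ : (fun _ => _) = fun t => \sum_(0 <= n < N.+1)
      (complex.Re (u * c n) * cos (lam n * t) + complex.Im (u * c n) * sin (lam n * t))).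
    apply: continuous_big => [|n _ t]; first exact: add_continuous.
    apply: cvgD; apply: cvgM; try exact: cvg_cst.
      by apply: (@continuous_comp _ _ _ ( *%R (lam n)) (@cos R)); [apply: mulrl_continuous|apply: continuous_cos].
    by apply: (@continuous_comp _ _ _ ( *%R (lam n)) (@sin R)); [apply: mulrl_continuous|apply: continuous_sin].
  apply/funext => t; apply: eq_bigr => n _.
  by rewrite /g /expi cosN sinN; case: (u * c n) => x y; simpc => /=; ring.
- move=> t; rewrite /g -Re_sum.
  rewrite (_ : \sum_(0 <= n < N.+1) _ = u * expsum lam N c (Complex 0 t)).
    by apply: le_trans (ler_norm _) _; apply: le_trans (Re_le_normc _) _; rewrite Normc.normcM u1 mul1r.
  by rewrite /expsum mulr_sumr; apply: eq_bigr => n _; rewrite cexp_im mulrA.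
- rewrite -sumrB -uE /expsum mulr_sumr Re_sum mulr_sumr.
  apply: eq_bigr => n _; rewrite (HG n).2// cexp_im /avg.
  by congr (_ * complex.Re _); ring.
Qed.

Lemma avg_sup lam N c h T B : 0 < h ->
  (forall t, 0 <= t <= T -> nm (expsum lam N c (Complex 0 t)) <= B) ->
  forall t, 0 <= t <= T - h -> nm (expsum lam N (avg lam h c) (Complex 0 t)) <= B.
Proof.
move=> h0 HB s /andP[s0 sT].
have [G [dG [HG cdG dGle e]]] := expsum_avg_primitive lam N c s h0.
have sh : s <= s + h by lra.
have cG : {within `[s, s + h], continuous G}.
  apply: continuous_subspaceT => y.
  by apply/differentiable_continuous/derivable1_diffP; case: (HG y).
have [x + e'] := MVT_segment sh (fun y _ => HG y) cG.
rewrite in_itv/= => /andP[sx xh].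
rewrite -(ler_pM2l h0) -e e' addrC addKr mulrC ler_pM2l// (le_trans (dGle x))//.
by apply: HB; apply/andP; split; lra.
Qed.

Lemma avg_L1 lam N c h H : 0 < h ->
  forall t, 0 <= t <= H - h -> nm (expsum lam N (avg lam h c) (Complex 0 t)) <=
    h^-1 * \int[mu]_(t in `[0, H]) nm (expsum lam N c (Complex 0 t)).
Proof.
move=> h0 s /andP[s0 sT].
have [G [dG [HG cdG dGle e]]] := expsum_avg_primitive lam N c s h0.
have sh : s < s + h by lra.
have cG : continuous G.
  by move=> y; apply/differentiable_continuous/derivable1_diffP; case: (HG y).
rewrite mulrC ler_pdivlMr// mulrC -e.
have cF := @continuous_expsum lam N c.
have iF a b : mu.-integrable `[a, b] (EFin \o (fun t => nm (expsum lam N c (Complex 0 t)))).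
  by apply: continuous_compact_integrable; [exact: segment_compact|exact: continuous_subspaceT].
have idG : mu.-integrable `[s, s + h] (EFin \o dG).
  by apply: continuous_compact_integrable; [exact: segment_compact|exact: continuous_subspaceT].
have -> : G (s + h) - G s = \int[mu]_(t in `[s, s + h]) dG t.
  rewrite /Rintegral (@continuous_FTC2 _ dG G)//.
  - exact: continuous_subspaceT.
  - split.
    + by move=> x _; case: (HG x).
    + by apply: cvg_at_right_filter; exact: cG.
    + by apply: cvg_at_left_filter; exact: cG.
  - by move=> x _; rewrite derive1E; case: (HG x).
apply: (@le_trans _ _ (\int[mu]_(t in `[s, s + h]) nm (expsum lam N c (Complex 0 t)))).
  by apply: le_Rintegral => //.
rewrite /Rintegral fine_le//.
- exact: integrable_fin_num.
- exact: integrable_fin_num.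
apply: ge0_subset_integral => //.
- by case/integrableP: (iF 0 H).
- by move=> x _; rewrite lee_fin normc_ge0.
- move=> x /=; rewrite !in_itv/= => /andP[? ?]; apply/andP; split; lra.
Qed.

End Averages.

(** * Choice of the averages *)

Section Smoothing.
Context {R : realType}.
Local Notation nm := (@Normc.normc R).
Local Notation mu := (@lebesgue_measure R).

Lemma avg_iter_sup lam N (c : nat -> R[i]) h T B m : 0 < h ->
  (forall t, 0 <= t <= T -> nm (expsum lam N c (Complex 0 t)) <= B) ->
  forall t, 0 <= t <= T - m%:R * h ->
    nm (expsum lam N (fun n => c n * sincc (lam n * h) ^+ m) (Complex 0 t)) <= B.
Proof.
move=> h0 HB; elim: m => [|m IH] t ht.
  under eq_fun do rewrite expr0 mulr1.
  by apply: HB; rewrite mul0r subr0 in ht.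
rewrite (_ : (fun n => _) = avg lam h (fun n => c n * sincc (lam n * h) ^+ m)).
  apply: (avg_sup h0 IH); move: ht; rewrite -natr1; lra.
by apply/funext => n; rewrite /avg exprSr mulrA.
Qed.

(** A window of length h must fit inside the interval, so each average shortens the interval by h;
    the sum is the total length spent. *)
Lemma avg_levels_sup lam N (c : nat -> R[i]) T B (h : nat -> R) (m : nat -> nat) k0 k1 :
  (k0 <= k1)%N -> (forall k, 0 < h k) ->
  (forall t, 0 <= t <= T -> nm (expsum lam N c (Complex 0 t)) <= B) ->
  forall t, 0 <= t <= T - \sum_(k0 <= k < k1) (m k)%:R * h k ->
    nm (expsum lam N (fun n => c n * \prod_(k0 <= k < k1) sincc (lam n * h k) ^+ m k)
      (Complex 0 t)) <= B.
Proof.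
move=> k01 h0 HB; rewrite -(subnKC k01); elim: (k1 - k0)%N => [|k IH] t ht.
  under eq_fun do rewrite addn0 big_geq// mulr1.
  by apply: HB; rewrite addn0 big_geq// subr0 in ht.
rewrite (_ : (fun n => _) = fun n => (c n * \prod_(k0 <= i < k0 + k) sincc (lam n * h i) ^+ m i)
    * sincc (lam n * h (k0 + k)%N) ^+ m (k0 + k)%N).
  apply: (avg_iter_sup (h0 _) IH).
  by move: ht; rewrite addnS big_nat_recr ?leq_addr//=; lra.
by apply/funext => n; rewrite addnS big_nat_recr ?leq_addr//= mulrA.
Qed.

Lemma small_tail (x : nat -> R) (M : R) : (forall k, 0 <= x k) ->
  (forall k, \sum_(0 <= i < k) x i <= M) ->
  forall eta, 0 < eta -> exists k0, forall k1, (k0 <= k1)%N ->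
    \sum_(k0 <= k < k1) x k <= eta.
Proof.
move=> x0 xM eta eta0; pose P := [set \sum_(0 <= i < k) x i | k in [set: nat]].
have hs : has_sup P.
  by split; [exists (\sum_(0 <= i < 0) x i), 0%N|exists M => _ [k _ <-]].
have [_ [k0 _ <-] H] := sup_adherent eta0 hs.
exists k0 => k1 k01.
have : \sum_(0 <= i < k1) x i <= sup P by apply: sup_upper_bound => //; exists k1.
by rewrite (big_cat_nat (leq0n k0) k01)/=; lra.
Qed.

Lemma half_powers_sum k : \sum_(0 <= i < k) (2%:R ^- i : R) <= 2.
Proof.
suff -> : \sum_(0 <= i < k) (2%:R ^- i : R) = 2 - 2 * 2 ^- k.
  by rewrite gerBl mulr_ge0.
elim: k => [|k IH]; first by rewrite big_geq// expr0 invr1 mulr1 subrr.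
by rewrite big_nat_recr//= IH exprS invfM; field.
Qed.

Lemma pow2_unbounded (x : R) : exists k, x < 2 ^+ k.
Proof.
exists (Num.truncn x).+1; apply: lt_trans (truncnS_gt x) _.
by rewrite -natrX ltr_nat ltn_expl.
Qed.

(** The number of halvings must be linear in ln b for the lengths to be summable. The factor 2 comes
    from e^(1/2) <= 2. *)
Lemma exists_pow2_exponent (b : R) : 1 <= b ->
  exists m : nat, b <= 2 ^+ m /\ m%:R <= 2 * ln b + 1.
Proof.
move=> b1; have l0 : 0 <= ln b by exact: ln_ge0.
pose m := (Num.truncn (2 * ln b)).+1; exists m.
have mgt : 2 * ln b < m%:R by exact: truncnS_gt.
split; last first.
  by rewrite /m -natr1 lerD2r truncn_le mulr_ge0.
have e2 : expR 2^-1 <= 2 :> R.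
  rewrite -[expR _]invrK -expRN -[leRHS]invrK lef_pV2 ?posrE ?expR_gt0//.
  by have := @expR_ge1Dx R (- 2^-1); lra.
rewrite -(@lnK _ b) ?posrE//; last by lra.
apply: (@le_trans _ _ (expR (m%:R * 2^-1))); first by rewrite ler_expR; lra.
by rewrite expRM_natl lerXn2r ?nnegrE ?expR_ge0.
Qed.

Variables (lam A B : nat -> R) (M : R).
Hypotheses (lam0 : lam 0%N = 0) (lam_incr : forall n, lam n < lam n.+1).
Hypotheses (A0 : A 0%N = 1) (A_gt0 : forall n, (1 <= n)%N -> 0 < A n).
(** [B k] stands for a majorant of Λ(2^k), and [HM] for the convergence of the logarithmic integral.
    The shift to [B i.+1] is there because frequencies in [2^i, 2^(i+1)] are charged with the
    partial sum up to 2^(i+1). *)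
Hypothesis HB : forall k n, lam n <= 2 ^+ k -> \sum_(0 <= i < n.+1) A i <= B k.
Hypothesis HM : forall k, \sum_(0 <= i < k) ln (B i.+1) / 2 ^+ i <= M.

Let S n := \sum_(0 <= i < n.+1) A i.

Let A_ge0 n : 0 <= A n.
Proof. by case: n => [|n]; [rewrite A0|exact/ltW/A_gt0]. Qed.

Let SS n : S n.+1 = S n + A n.+1.
Proof. by rewrite /S big_nat_recr. Qed.

Let S_ge1 n : 1 <= S n.
Proof.
elim: n => [|n IH]; first by rewrite /S big_nat1 A0.
by rewrite SS ler_wpDr.
Qed.

Let lam_mono n m : (n <= m)%N -> lam n <= lam m.
Proof. by have /nondecreasing_seqP := fun n => ltW (lam_incr n); apply. Qed.

Let B_ge1 k : 1 <= B k.
Proof. by apply: le_trans (S_ge1 0) _; apply: HB; rewrite lam0 exprn_ge0. Qed.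

(* If w n <= 1 always, and w n <= S_n^-2 when lam n is beyond 2^k0, the
   weighted sum telescopes, since A_n / S_n^2 <= 1/S_(n-1) - 1/S_n. *)
Let weighted_sum (w : nat -> R) k0 N :
  (forall n, 0 <= w n <= 1) ->
  (forall n, (n <= N)%N -> 2 ^+ k0 <= lam n -> w n <= (S n)^-1 ^+ 2) ->
  \sum_(0 <= n < N.+1) A n * w n <= B k0 + 1 - (S N)^-1.
Proof.
move=> w01; elim: N => [|N IH] Hw.
  rewrite big_nat1 /S big_nat1 A0 invr1 mul1r.
  by have := w01 0%N; have := B_ge1 k0; lra.
(* Below the cut no decay is known, but the whole sum is then at most S_(N+1) <= [B k0], and 1 -
   1/S_(N+1) >= 0. *)
have [lN|lN] := leP (2 ^+ k0) (lam N.+1); last first.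
  have : \sum_(0 <= n < N.+2) A n * w n <= S N.+1.
    by apply: ler_sum => n _; rewrite ler_piMr//; have := w01 n; lra.
  have := HB (ltW lN); rewrite -/(S N.+1).
  have : (S N.+1)^-1 <= 1 by rewrite invf_le1// (lt_le_trans ltr01).
  lra.
rewrite big_nat_recr//=.
have : A N.+1 * w N.+1 <= (S N)^-1 - (S N.+1)^-1.
  apply: le_trans (ler_wpM2l (A_ge0 _) (Hw _ (leqnn _) lN)) _.
  have s1 := S_ge1 N; have s2 := S_ge1 N.+1.
  have sn1 : S N != 0 by rewrite gt_eqF//; lra.
  have sn2 : S N.+1 != 0 by rewrite gt_eqF//; lra.
  have -> : A N.+1 = S N.+1 - S N by rewrite SS addrC addKr.
  have d0 : 0 <= S N.+1 - S N by rewrite SS addrC addKr.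
  rewrite (_ : (S N)^-1 - _ = (S N.+1 - S N) * ((S N)^-1 * (S N.+1)^-1)); last by field; rewrite sn1 sn2.
  rewrite ler_wpM2l// expr2 ler_wpM2r ?invr_ge0//; first by lra.
  by rewrite lef_pV2 ?posrE; lra.
suff : \sum_(0 <= i < N.+1) A i * w i <= B k0 + 1 - (S N)^-1 by lra.
by apply: IH => n nN; apply: Hw; rewrite ltnW.
Qed.

Lemma smoothing (H : R) : 0 < H -> exists2 K, 1 <= K & forall N a,
  a 0%N = 1 -> (forall n, (1 <= n <= N)%N -> nm (a n) <= A n) ->
  exists c, [/\ c 0%N = 1, \sum_(0 <= n < N.+1) nm (c n) <= K &
    forall t, 0 <= t <= H / 2 -> nm (expsum lam N c (Complex 0 t)) <=
      (H / 4)^-1 * \int[mu]_(t in `[0, H]) nm (expsum lam N a (Complex 0 t))].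
Proof.
move=> H0.
have [m Hm] := choice (fun k => exists_pow2_exponent (B_ge1 k.+1)).
(* If 2^k <= lam n <= 2^(k+1), then 2 / (lam n h_k) <= 1/4, so that m k averages
   of length h_k gain a factor 4^(- m k) <= B_(k+1)^-2 <= S_n^-2. *)
pose h k : R := 8 / 2 ^+ k.
have h_gt0 k : 0 < h k by rewrite /h divr_gt0// exprn_gt0.
have [k0 Hk0] : exists k0, forall k1, (k0 <= k1)%N ->
    \sum_(k0 <= k < k1) (m k)%:R * h k <= H / 4.
  (* m_k h_k <= (2 ln B_(k+1) + 1) 8 / 2^k, whose sum is at most 16 M + 8 * 2. *)
  apply: (@small_tail _ (16 * M + 16)); last by lra.
    by move=> k; rewrite mulr_ge0 ?ler0n// ltW.
  move=> k; apply: (@le_trans _ _ (\sum_(0 <= i < k) (16 * (ln (B i.+1) / 2 ^+ i) + 8 * 2 ^- i))).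
    apply: ler_sum => i _; rewrite /h.
    rewrite (_ : _ + _ = (2 * ln (B i.+1) + 1) * (8 / 2 ^+ i)); last by ring.
    by rewrite ler_wpM2r ?divr_ge0 ?exprn_ge0//; exact: (Hm i).2.
  rewrite big_split/= -!mulr_sumr.
  by have := HM k; have := half_powers_sum k; lra.
exists (B k0 + 1); first by have := B_ge1 k0; lra.
move=> N a a0 aA.
have [k1 lk1] := pow2_unbounded (lam N).
pose k2 := maxn k0 k1; have k02 : (k0 <= k2)%N by rewrite leq_maxl.
pose mult n := sincc (lam n * (H / 4)) * \prod_(k0 <= k < k2) sincc (lam n * h k) ^+ m k.
have mult1 n : nm (mult n) <= 1.
  rewrite /mult Normc.normcM mulr_ile1 ?normc_ge0 ?normc_sincc_le1// normc_prod.
  by apply: prodr_ile1 => k _; rewrite normcX exprn_ge0 ?normc_ge0// exprn_ile1 ?normc_ge0// normc_sincc_le1.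
have multS n : (n <= N)%N -> 2 ^+ k0 <= lam n -> nm (mult n) <= (S n)^-1 ^+ 2.
  move=> nN k0n.
  have [k [k0k kk2 k2n nk2]] : exists k, [/\ (k0 <= k)%N, (k < k2)%N, 2 ^+ k <= lam n & lam n <= 2 ^+ k.+1].
    have ex : exists j, lam n < 2 ^+ j by exact: pow2_unbounded.
    case: (ex_minnP ex) => j lj jmin.
    have k0j : (k0 < j)%N.
      rewrite ltnNge; apply/negP => jk0.
      have : 2 ^+ j <= 2 ^+ k0 :> R by rewrite ler_weXn2l// ler1n.
      by lra.
    case: j lj jmin k0j => // j lj jmin k0j; exists j; split => //.
    - have : (j.+1 <= k1)%N by apply: jmin; apply: le_lt_trans lk1; exact: lam_mono.
      by move=> jk1; rewrite /k2 leq_max jk1 orbT.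
    - by rewrite leNgt; apply/negP => /jmin; rewrite ltnn.
    - exact: ltW.
  have l0 : 0 < lam n by apply: lt_le_trans k2n; rewrite exprn_gt0.
  have sk : nm (sincc (lam n * h k)) <= 4^-1.
    apply: le_trans (normc_sincc_le _) _; first by rewrite mulf_neq0 ?gt_eqF.
    rewrite gtr0_norm ?mulr_gt0// ler_pdivrMr ?mulr_gt0//.
    rewrite /h mulrA mulrA ler_pdivlMr ?exprn_gt0//; lra.
  (* Only the level matching the size of [lam n] is kept; all other factors have modulus at most
     1. *)
  have : nm (mult n) <= nm (sincc (lam n * h k)) ^+ m k.
    rewrite /mult (bigD1_seq k) ?mem_index_iota ?k0k ?iota_uniq//=.
    rewrite mulrCA Normc.normcM normcX ler_piMr ?exprn_ge0 ?normc_ge0//.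
    rewrite Normc.normcM mulr_ile1 ?normc_ge0 ?normc_sincc_le1// normc_prod.
    by apply: prodr_ile1 => i _; rewrite normcX exprn_ge0 ?normc_ge0// exprn_ile1 ?normc_ge0// normc_sincc_le1.
  move=> /le_trans; apply.
  apply: (@le_trans _ _ ((2 ^- m k) ^+ 2)).
    rewrite -exprVn -exprM mulnC exprM (_ : 2^-1 ^+ 2 = 4^-1); last by rewrite expr2; field.
    by rewrite lerXn2r ?nnegrE ?normc_ge0.
  rewrite lerXn2r// ?nnegrE ?invr_ge0 ?exprn_ge0//; first by have := S_ge1 n; lra.
  rewrite lef_pV2 ?posrE ?exprn_gt0//; last by have := S_ge1 n; lra.
  by apply: le_trans (Hm k).1; exact: HB.
exists (fun n => a n * sincc (lam n * (H / 4)) * \prod_(k0 <= k < k2) sincc (lam n * h k) ^+ m k).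
split.
- rewrite a0 lam0 mul0r sincc0 !mul1r big1// => k _.
  by rewrite mul0r sincc0 expr1n.
- apply: (@le_trans _ _ (\sum_(0 <= n < N.+1) A n * nm (mult n))).
    rewrite !big_nat; apply: ler_sum => n /andP[_ nN].
    rewrite -mulrA -/(mult n) Normc.normcM ler_wpM2r ?normc_ge0//.
    by case: n nN => [|n] nN; [rewrite a0 normc_1 A0|apply: aA].
  apply: (@le_trans _ _ (B k0 + 1 - (S N)^-1)).
    by apply: weighted_sum => // n; rewrite normc_ge0 mult1.
  by rewrite gerBl invr_ge0; have := S_ge1 N; lra.
- move=> t /andP[t0 tH].
  have h4 : 0 < H / 4 by lra.
  (* The average of length H / 4 leaves [0, 3H/4]; the levels take at most another H / 4. *)
  apply: (avg_levels_sup k02 h_gt0 (avg_L1 _ _ _ h4)).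
  by have := Hk0 _ k02; lra.
Qed.

End Smoothing.

(** * Dyadic form of the logarithmic integral *)

Section LogIntegral.
Context {R : realType}.
Local Notation mu := (@lebesgue_measure R).

Lemma nondecreasing_emeasurable (D : set R) (g : R -> \bar R) : measurable D ->
  {homo g : x y / x <= y >-> (x <= y)%E} -> measurable_fun D g.
Proof.
move=> mD gnd; apply: (measurability (@ErealGenCInfty.G R)) => [|/= _ [_] [r] -> <-].
  exact: ErealGenCInfty.measurableE.
apply: measurableI => //; apply: is_interval_measurable => s t/=.
rewrite !in_itv/= !andbT => fs ft u /andP[su ut].
by rewrite in_itv/= andbT (le_trans fs)// gnd.
Qed.

Lemma measurable_inv_sqr : measurable_fun (`[(1 : R), +oo[ : set R) (fun x : R => x ^- 2).
Proof.
apply: (eq_measurable_fun (fun x : R => (Num.max 1 x) ^- 2)).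
  (* Truncating at 1 makes the function monotone on the whole line without changing it on the
     domain. *)
  move=> x; rewrite inE/= in_itv/= andbT => x1.
  by rewrite max_r.
apply: nonincreasing_measurable => // x y xy.
have m1 z : 0 < Num.max 1 z :> R by rewrite lt_max ltr01.
rewrite lef_pV2 ?posrE ?exprn_gt0// lerXn2r ?nnegrE ?(ltW (m1 _))//.
by rewrite ge_max !le_max lexx xy orbT.
Qed.

Lemma dyadic_le_integral (g : R -> \bar R) n :
  {homo g : x y / x <= y >-> (x <= y)%E} -> (forall x, 1 <= x -> (0 <= g x)%E) ->
  (\sum_(0 <= k < n) (g (2 ^+ k)%R * (4^-1 / 2 ^+ k)%:E) <=
    \int[mu]_(x in `[1%R, +oo[) (g x * (x ^- 2)%:E))%E.
Proof.
move=> gnd g0.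
have p1 k : 1 <= 2 ^+ k :> R by rewrite exprn_ege1// ler1n.
pose f x := (g x * (x ^- 2)%:E)%E.
have mf : measurable_fun (`[(1 : R), +oo[ : set R) f.
  apply: emeasurable_funM; first exact: nondecreasing_emeasurable.
  by apply/measurable_EFinP; exact: measurable_inv_sqr.
have f0 x : 1 <= x -> (0 <= f x)%E.
  by move=> x1; rewrite mule_ge0 ?g0// lee_fin invr_ge0 sqr_ge0.
have sub a b : 1 <= a -> [set` `[a, b[] `<=` [set` `[1, +oo[].
  by move=> a1 x /=; rewrite !in_itv/= andbT => /andP[ax _]; exact: le_trans ax.
suff H : (\sum_(0 <= k < n) (g (2 ^+ k)%R * (4^-1 / 2 ^+ k)%:E) <=
    \int[mu]_(x in `[1%R, (2 ^+ n)%R[) f x)%E.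
  apply: le_trans H _; apply: ge0_subset_integral => //; last exact: sub.
  by move=> x /=; rewrite in_itv/= andbT => x1; exact: f0.
elim: n => [|n IH].
  by rewrite big_geq// integral_ge0// => x /=; rewrite in_itv/= => /andP[x1 _]; exact: f0.
rewrite big_nat_recr//=.
have n1 : 2 ^+ n <= 2 ^+ n.+1 :> R by rewrite ler_weXn2l// ler1n.
have -> : `[1, (2 ^+ n.+1)%R[%classic = `[1, (2 ^+ n)%R[ `|` `[(2 ^+ n)%R, (2 ^+ n.+1)%R[ :> set R.
  apply/seteqP; split=> x /=; rewrite !in_itv/=.
    by move=> /andP[x1 xn]; have [h|h] := ltP x (2 ^+ n); [left; rewrite x1|right].
  move=> [/andP[x1 xn]|/andP[xn xn1]].
    by rewrite x1 (lt_le_trans xn).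
  by rewrite xn1 (le_trans (p1 n)).
rewrite ge0_integral_setU//; last 3 first.
- apply: measurable_funS mf => // x [|]; exact: sub.
- by move=> x [|] /sub H; apply: f0; have := H; rewrite /= ?in_itv/= ?andbT; apply.
- rewrite disj_set2E; apply/eqP/seteqP; split=> x //= [].
  by rewrite !in_itv/= => /andP[_ xn] /andP[nx _]; move: xn; rewrite ltNge nx.
apply: leeD => //.
(* On this block g is at least its value at the left end and x^-2 at least 4^-(n+1); the length is
   2^n, whence the weight 1 / (4 * 2^n). *)
apply: (@le_trans _ _ (\int[mu]_(x in `[(2 ^+ n)%R, (2 ^+ n.+1)%R[) cst (g (2 ^+ n)%R * ((2 ^+ n.+1) ^- 2)%:E)%E x)%E).
  rewrite integral_cst//= lebesgue_measure_itv/= lte_fin ltr_eXn2l ?ltr1n// ltnSn.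
  rewrite -EFinB -muleA -EFinM (_ : _ / _ = 2 ^+ n.+1 ^- 2 * (2 ^+ n.+1 - 2 ^+ n))//.
  by rewrite (exprS 2 n); field; rewrite expf_neq0.
apply: ge0_le_integral => //.
- by move=> x _; rewrite mule_ge0 ?g0// lee_fin invr_ge0 sqr_ge0.
- by apply: measurable_funS mf => //; exact: sub.
- move=> x /=; rewrite in_itv/= => /andP[nx xn].
  have x1 : 1 <= x by exact: le_trans nx.
  rewrite /f lee_pmul ?g0// ?lee_fin ?invr_ge0 ?sqr_ge0//; first exact: gnd.
  rewrite lef_pV2 ?posrE ?exprn_gt0//; last exact: lt_le_trans x1.
  by rewrite lerXn2r// ?nnegrE ltW//; exact: lt_le_trans x1.
Qed.

Variables (lam A : nat -> R).
Hypotheses (lam0 : lam 0%N = 0) (lam_incr : forall n, lam n < lam n.+1).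
Hypotheses (A0 : A 0%N = 1) (A_gt0 : forall n, (1 <= n)%N -> 0 < A n).

Let A_ge0 n : 0 <= A n.
Proof. by case: n => [|n]; [rewrite A0|exact/ltW/A_gt0]. Qed.

Lemma Lambda_homo : {homo Lambda lam A : x y / x <= y >-> (x <= y)%E}.
Proof.
move=> x y xy; rewrite /Lambda; apply: ge_ereal_sup => _ [X [fX Xx]] <-.
apply: esum_ge; exists X => //; split=> // n /Xx /= h; exact: le_trans xy.
Qed.

Lemma sum_le_Lambda n x : lam n <= x ->
  ((\sum_(0 <= i < n.+1) A i)%:E <= Lambda lam A x)%E.
Proof.
move=> nx; apply: esum_ge; exists `I_n.+1.
  split; first exact: finite_II.
  move=> i /= iN; apply: le_trans nx.
  by have /nondecreasing_seqP := fun n => ltW (lam_incr n); apply.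
by rewrite -fsbig_ord -sumEFin big_mkord.
Qed.

Lemma Lambda_ge1 x : 0 <= x -> (1 <= Lambda lam A x)%E.
Proof.
move=> x0; apply: (@le_trans _ _ (\sum_(0 <= i < 1) A i)%:E).
  by rewrite big_nat1 A0.
by apply: sum_le_Lambda; rewrite lam0.
Qed.

Lemma Lambda_ge0 x : (0 <= Lambda lam A x)%E.
Proof. by apply: esum_ge0 => n _; rewrite lee_fin. Qed.

Lemma dyadic_log_bound :
  (\int[mu]_(x in `[1%R, +oo[) (lne (Lambda lam A x) * (x ^- 2)%:E) < +oo)%E ->
  exists B : nat -> R, exists M : R,
    (forall k n, lam n <= 2 ^+ k -> \sum_(0 <= i < n.+1) A i <= B k) /\
    (forall k, \sum_(0 <= i < k) ln (B i.+1) / 2 ^+ i <= M).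
Proof.
set I := (X in (X < _)%E) => Ioo.
pose g x := lne (Lambda lam A x).
have gnd : {homo g : x y / x <= y >-> (x <= y)%E}.
  by move=> x y xy; rewrite /g lee_lne ?in_itv/= ?Lambda_ge0 ?leey//; exact: Lambda_homo.
have g0 x : 1 <= x -> (0 <= g x)%E.
  by move=> x1; rewrite /g lne_ge0 Lambda_ge1// (le_trans ler01).
have dy n := @dyadic_le_integral g n gnd g0.
have p1 k : 1 <= 2 ^+ k :> R by rewrite exprn_ege1// ler1n.
have t0 k : (0 <= g (2 ^+ k)%R * (4^-1 / 2 ^+ k)%:E)%E.
  by rewrite mule_ge0 ?g0// lee_fin divr_ge0 ?exprn_ge0.
(* An infinite Λ(2^k) would make its own dyadic term infinite, against the finite integral. *)
have Lfin k : Lambda lam A (2 ^+ k) \is a fin_num.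
  rewrite ge0_fin_numE ?Lambda_ge0// ltey; apply/eqP => Loo.
  have := le_lt_trans (dy k.+1) Ioo; rewrite big_nat_recr//= {2}/g Loo /=.
  rewrite gt0_mulye ?lte_fin ?divr_gt0 ?exprn_gt0// addey//.
  by rewrite gt_eqF// (@lt_le_trans _ _ 0%E)//; apply: sume_ge0.
pose B k := fine (Lambda lam A (2 ^+ k)).
have BE k : Lambda lam A (2 ^+ k) = (B k)%:E by rewrite fineK.
have B1 k : 1 <= B k by rewrite -lee_fin -BE Lambda_ge1// (le_trans ler01).
have gB k : g (2 ^+ k) = (ln (B k))%:E by rewrite /g BE lne_EFin// (lt_le_trans ltr01).
have I0 : (0 <= I)%E by have := dy 0%N; rewrite big_geq.
have Ifin : I \is a fin_num by rewrite ge0_fin_numE.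
(* The weight 1 / 2^i is 8 times the weight (1/4) / 2^(i+1); the term of index 0 is nonnegative and
   dropped. *)
exists B, (8 * fine I); split.
  by move=> k n nk; rewrite -lee_fin -BE; exact: sum_le_Lambda.
move=> k; have := dy k.+1; rewrite -/I -(fineK Ifin) big_nat_recl//= !gB.
under eq_bigr do rewrite gB -EFinM.
rewrite sumEFin -EFinM -EFinD lee_fin => H.
have : 0 <= ln (B 0%N) * (4^-1 / 2 ^+ 0) by rewrite mulr_ge0 ?ln_ge0// divr_ge0.
have : \sum_(0 <= i < k) ln (B i.+1) / 2 ^+ i =
    8 * \sum_(0 <= i < k) (ln (B i.+1) * (4^-1 / 2 ^+ i.+1)).
  rewrite mulr_sumr; apply: eq_bigr => i _; rewrite exprS; field.
  by rewrite expf_neq0.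
lra.
Qed.

End LogIntegral.

(** * Existence of the minimum *)

Section Minimum.
Context {R : realType}.
Local Notation nm := (@Normc.normc R).
Local Notation mu := (@lebesgue_measure R).

Lemma compact_disc (r : R) : compact [set p : R * R | nm (C_of p) <= r].
Proof.
apply: (@subclosed_compact _ _ (`[- r, r] `*` `[- r, r])).
- rewrite (_ : [set p | _] = (fun p => nm (C_of p)) @^-1` [set y | y <= r])//.
  apply: closed_comp => [p _|]; last exact: closed_le.
  by apply: (taylor2_continuous (f := fun w => w)) => z; exact: taylor2_id.
- by apply: compact_setX; exact: segment_compact.
- move=> p /= pr; have := Re_le_normc (C_of p); have := Im_le_normc (C_of p).
  rewrite /= => h1 h2.
  by split; rewrite /= in_itv/= -ler_norml; [exact: le_trans h2 pr|exact: le_trans h1 pr].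
Qed.

(** Induction on the number of coefficients: with the last one frozen at z, the others are minimised
    by induction, and the resulting minimum [m z] is again Lipschitz in z, hence attained on a disc.
    A general Lipschitz [G] is needed because freezing a coefficient changes the function. *)
Lemma lipschitz_min (A : nat -> R) (A0 : forall n, 0 <= A n) (C : R) (C0 : 0 <= C) N
    (G : (nat -> R[i]) -> R) :
  (forall a b, G a <= G b + C * \sum_(1 <= n < N.+1) nm (a n - b n)) ->
  exists2 a, admissible A N a & forall b, admissible A N b -> G a <= G b.
Proof.
elim: N G => [|N IH] G HG.
  exists (fun=> 0) => [n|b _]; first by rewrite leqn0; case: n.
  by have := HG (fun=> 0) b; rewrite big_geq// mulr0 addr0.
pose upd (z : R[i]) (a : nat -> R[i]) n := if n == N.+1 then z else a n.
have /choice[b Hb] z : exists b, admissible A N b /\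
    forall b', admissible A N b' -> G (upd z b) <= G (upd z b').
  have [|b b1 b2] := IH (fun a => G (upd z a)); last by exists b.
  move=> a b; apply: le_trans (HG _ (upd z b)) _; rewrite lerD2l ler_wpM2l//.
  rewrite big_nat_recr//= /upd eqxx subrr normc_0 addr0 !big_nat.
  by apply: ler_sum => n /andP[_ nN]; rewrite ltn_eqF.
pose m z := G (upd z (b z)).
have mlip z z' : m z <= m z' + C * nm (z - z').
  (* The minimiser for z' is a competitor for z. *)
  apply: le_trans ((Hb z).2 _ (Hb z').1) _.
  apply: le_trans (HG _ (upd z' (b z'))) _; rewrite lerD2l ler_wpM2l//.
  rewrite big_nat_recr//= {3 4}/upd eqxx gerDr big_nat big1// => n /andP[_ nN].
  by rewrite /upd ltn_eqF// subrr normc_0.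
have cm : continuous (fun p => m (C_of p)).
  move=> p; apply: (continuous_of_lip C0) => q _ _.
  have pq : nm (C_of q - C_of p) <= `|q.1 - p.1| + `|q.2 - p.2|.
    exact: normc_le_ReIm.
  apply: (@le_trans _ _ (C * nm (C_of q - C_of p))); last by rewrite ler_wpM2l.
  have := mlip (C_of q) (C_of p); have := mlip (C_of p) (C_of q).
  by rewrite (normc_distC (C_of p)) ler_norml => h1 h2; apply/andP; split; lra.
have [|p pA Hp] := compact_EVT_min _ (@compact_disc (A N.+1)) (continuous_subspaceT cm).
  by exists (0, 0) => /=; rewrite expr0n/= addr0 sqrtr0.
rewrite inE/= in pA.
exists (upd (C_of p) (b (C_of p))) => [n /andP[n1]|b' Hb'].
  rewrite leq_eqVlt /upd; case: eqP => [-> _ //|_ /= nN].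
  by apply: (Hb (C_of p)).1; rewrite n1.
apply: (@le_trans _ _ (m (b' N.+1))).
  have -> : b' N.+1 = C_of (complex.Re (b' N.+1), complex.Im (b' N.+1)) by case: (b' N.+1).
  apply: Hp; rewrite inE/=.
  have := Hb' N.+1; rewrite leqnn => /(_ isT).
  by case: (b' N.+1).
rewrite [X in _ <= G X](_ : b' = upd (b' N.+1) b').
  apply: (Hb _).2 => n /andP[n1 nN]; apply: Hb'; rewrite n1/=; exact: ltnW.
by apply/funext => n; rewrite /upd; case: eqP => [->|].
Qed.

(** Turns the constant 1 into the coefficient of the frequency [lam 0 = 0], whatever [a 0] is. *)
Definition pad (a : nat -> R[i]) (n : nat) : R[i] := if n == 0%N then 1 else a n.

Lemma L1distE lam H N a : lam 0%N = 0 -> L1dist lam H N a =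
  \int[mu]_(t in `[0, H]) nm (expsum lam N (pad a) (Complex 0 t)).
Proof.
move=> lam0; apply: eq_Rintegral => t _; congr nm.
rewrite /expsum [RHS]big_nat_recl// lam0 cexp_im mul0r oppr0 expi0 mulr1; congr (_ + _).
by rewrite big_add1; apply: eq_bigr => n _; rewrite cexp_im.
Qed.

Lemma integrable_expsum lam N c (H : R) :
  mu.-integrable `[0, H] (EFin \o (fun t => nm (expsum lam N c (Complex 0 t)))).
Proof.
apply: continuous_compact_integrable; first exact: segment_compact.
by apply: continuous_subspaceT; exact: continuous_expsum.
Qed.

Lemma L1dist_lip lam H N a b : 0 <= H -> lam 0%N = 0 ->
  L1dist lam H N a <= L1dist lam H N b + H * \sum_(1 <= n < N.+1) nm (a n - b n).
Proof.
move=> H0 lam0; rewrite !L1distE//; set s := \sum_(1 <= n < N.+1) _.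
have ics : mu.-integrable `[0, H] (EFin \o cst s).
  by apply: continuous_compact_integrable;
    [exact: segment_compact|apply: continuous_subspaceT => x; exact: cvg_cst].
have -> : H * s = \int[mu]_(t in `[0, H]) cst s t.
  rewrite Rintegral_cst//= lebesgue_measure_itv/= lte_fin.
  case: ltP => [h|h]; first by rewrite sube0 mulrC.
  by rewrite (le_anti (introT andP (conj h H0))) mul0r mulr0.
rewrite -RintegralD//; last exact: integrable_expsum.
apply: le_Rintegral => //; first exact: integrable_expsum.
  have := @integrableD _ _ _ mu `[0, H] _ _ _ (integrable_expsum lam N (pad b) H) ics.
  by apply.
move=> t _.
have -> : expsum lam N (pad a) (Complex 0 t) = expsum lam N (pad b) (Complex 0 t) +
   \sum_(1 <= n < N.+1) (a n - b n) * expi (- (lam n * t)).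
  rewrite /expsum !(@big_ltn _ _ _ 0)// -addrA; congr (_ + _).
  rewrite -big_split/= !big_nat; apply: eq_bigr => -[//|n] _.
  by rewrite cexp_im /pad /=; ring.
apply: le_trans (normcD _ _) _; rewrite lerD2l; apply: le_trans (normc_sum _ _ _) _.
by apply: ler_sum => n _; rewrite Normc.normcM normc_expi mulr1.
Qed.

(** A competitor for N, continued by a zero coefficient, competes for N + 1; hence the minima
    decrease and their limit exists. *)
Lemma L1dist_extend lam H N (a : nat -> R[i]) :
  L1dist lam H N.+1 (fun n => if n == N.+1 then 0 else a n) = L1dist lam H N a.
Proof.
apply: eq_Rintegral => t _; congr (nm (1 + _)).
rewrite big_nat_recr//= eqxx mul0r addr0 !big_nat; apply: eq_bigr => n /andP[_ nN].
by rewrite ltn_eqF.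
Qed.

Lemma L1dist_lower_bound (lam A : nat -> R)
  (lam0 : lam 0%N = 0) (lam_incr : forall n, lam n < lam n.+1)
  (A0 : A 0%N = 1) (A_gt0 : forall n, (1 <= n)%N -> 0 < A n)
  (log_int : (\int[mu]_(x in `[1%R, +oo[)
                (lne (Lambda lam A x) * (x ^- 2)%:E) < +oo)%E)
  (H : R) : 0 < H ->
  exists2 delta, 0 < delta & forall N a, admissible A N a -> delta <= L1dist lam H N a.
Proof.
move=> H0.
have [B [M [HB HM]]] := dyadic_log_bound lam0 lam_incr A0 A_gt0 log_int.
have [K K1 HK] := smoothing lam0 lam_incr A0 A_gt0 HB HM H0.
have l1 : 0 < lam 1%N by rewrite -lam0.
have H2 : 0 < H / 2 by lra.
have [delta d0 Hd] := expsum_lower_bound l1 K1 H2.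
exists (delta * (H / 4)); first by rewrite mulr_gt0//; lra.
move=> N a Ha; rewrite L1distE//.
have [|n /andP[n1 nN]|c [c0 cK cs]] := HK N (pad a); first by [].
  by rewrite /pad gtn_eqF//; apply: Ha; rewrite n1.
have mono n m : (n <= m)%N -> lam n <= lam m.
  by have /nondecreasing_seqP := fun n => ltW (lam_incr n); apply.
have := Hd lam N c lam0 (fun n => @mono 1 n) c0 cK _ cs.
by rewrite ler_pdivlMl 1?mulrC//; lra.
Qed.

End Minimum.

Theorem theorem2 (R : realType) (lam A : R^nat)
  (lam0 : lam 0%N = 0)
  (lam_incr : forall n : nat, lam n < lam n.+1)
  (A0 : A 0%N = 1)
  (A_gt0 : forall n : nat, (1 <= n)%N -> 0 < A n)
  (log_int : (\int[lebesgue_measure]_(x in `[1%R, +oo[)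
                (lne (Lambda lam A x) * (x ^- 2)%:E) < +oo)%E)
  (H : R) (H_gt0 : 0 < H) :
  exists m : R^nat,
    [/\ forall N : nat, is_minimum (L1dist lam H N @` admissible A N) (m N),
        cvgn m & 0 < limn m].
Proof.
have [delta d0 Hd] := L1dist_lower_bound lam0 lam_incr A0 A_gt0 log_int H_gt0.
have A_ge0 n : 0 <= A n by case: n => [|n]; [rewrite A0|exact/ltW/A_gt0].
have /choice[a Ha] N : exists a, admissible A N a /\
    forall b, admissible A N b -> L1dist lam H N a <= L1dist lam H N b.
  have [a a1 a2] := lipschitz_min A_ge0 (ltW H_gt0)
    (fun a b => L1dist_lip N a b (ltW H_gt0) lam0).
  by exists a.
pose m N := L1dist lam H N (a N).
have m_ge N : delta <= m N by exact/Hd/(Ha N).1.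
have m_noninc : nonincreasing_seq m.
  apply/nonincreasing_seqP => N; rewrite /m -(L1dist_extend lam H N (a N)).
  apply: (Ha N.+1).2 => n /andP[n1 nN]; case: eqP => [_|/eqP nN1].
    by rewrite normc_0.
  by apply: (Ha N).1; rewrite n1 -ltnS ltn_neqAle nN1.
have cm : cvgn m.
  by apply: nonincreasing_is_cvgn => //; exists delta => _ [n _ <-].
exists m; split => //.
  move=> N; split; first by exists (a N) => //; exact: (Ha N).1.
  by move=> _ [b Hb <-]; exact: (Ha N).2.
by apply: lt_le_trans d0 _; apply: limr_ge => //; exact: nearW.
Qed.
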